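(* The reduced configuration space $\mathrm{BConf}(5)[1+\sqrt2]=\mathrm{BConf}(5;\frac{\pi}{2})$ of configurations of $5$ labeled points attaining the maximal radius $r_{max}(5)=1+\sqrt2$ is a simplicial $2$-complex (i.e. it is homeomorphic to a finite $2$-dimensional simplicial complex) which is not contractible. It has a single connected component, and its Euler characteristic is $\chi(\mathrm{BConf}(5;\frac\pi2))=-10$.
   Context: $\mathrm{Conf}(5;\theta)$ is the set of $(\mathbf u_1,\dots,\mathbf u_5)\in(\mathbb S^2)^5$, with $\mathbb S^2\subset\mathbb R^3$ the unit sphere, whose pairwise angular distances are all at least $\theta$, and $\mathrm{BConf}(5;\theta)=\mathrm{Conf}(5;\theta)/SO(3)$ is the quotient by the diagonal rotation action. In the radius parametrization, $\mathrm{BConf}(5)[r]=\mathrm{BConf}(5;\theta)$ with $\sin\frac\theta2=\frac{r}{1+r}$; it describes $5$ labeled non-overlapping spheres of radius $r$ touching a central unit sphere. $r_{max}(5)=1+\sqrt2$ (equivalently $\theta=\pi/2$) is the largest $r$ for which this space is nonempty. *)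

(* Defs.v *)
From HB Require Import structures.
From mathcomp Require Import all_boot all_order all_algebra generic_quotient.
From mathcomp Require Import all_classical all_reals all_analysis.

Set Implicit Arguments.
Unset Strict Implicit.
Unset Printing Implicit Defensive.

Import Order.TTheory GRing.Theory Num.Theory.
Import numFieldNormedType.Exports.

Local Open Scope classical_set_scope.
Local Open Scope quotient_scope.
Local Open Scope ring_scope.

(* Vectors of R^3 are rows.  The norm carried by 'rV[R]_3 is the sup norm, so
   the Euclidean structure is introduced through the dot product. *)
Definition dotv (R : realType) (u v : 'rV[R]_3) : R := (u *m v^T) 0 0.

Definition sphere2 (R : realType) : set 'rV[R]_3 := [set u | dotv u u = 1].

Definition angular_dist (R : realType) (u v : 'rV[R]_3) : R := acos (dotv u v).

(* The i-th labeled point of a configuration is the i-th row of the matrix;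
   'M[R]_(N, 3) has the product topology, and the set Conf N theta, used as a
   type, has the topology induced from it. *)
Definition Conf (R : realType) (N : nat) (theta : R) : set 'M[R]_(N, 3) :=
  [set U | (forall i : 'I_N, sphere2 (row i U)) /\
           (forall i j : 'I_N, i != j ->
              theta <= angular_dist (row i U) (row j U))].

Arguments Conf {R} N theta.

Definition SO3 (R : realType) : set 'M[R]_3 :=
  [set A | A *m A^T = 1%:M /\ \det A = 1].

(* Right multiplication by A^T sends each row u to the row of A u. *)
Definition same_orbit (R : realType) (N : nat) (theta : R)
    (U V : Conf N theta) : bool :=
  `[< exists2 A : 'M[R]_3, SO3 A & set_val V = set_val U *m A^T >].

Section SameOrbitEquiv.
Variables (R : realType) (N : nat) (theta : R).

Lemma same_orbit_refl : reflexive (@same_orbit R N theta).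
Proof.
move=> U; apply/asboolP; exists 1%:M; last by rewrite trmx1 mulmx1.
by split; rewrite ?det1 // trmx1 mulmx1.
Qed.

Lemma same_orbit_sym : symmetric (@same_orbit R N theta).
Proof.
have half (U V : Conf N theta) : same_orbit U V -> same_orbit V U.
  move=> /asboolP[A [AAT dA] VE]; apply/asboolP; exists A^T.
    by split; rewrite ?det_tr // trmxK; exact: mulmx1C.
  by rewrite VE trmxK -mulmxA (mulmx1C AAT) mulmx1.
by move=> U V; apply/idP/idP; exact: half.
Qed.

Lemma same_orbit_trans : transitive (@same_orbit R N theta).
Proof.
move=> V U W /asboolP[A [AAT dA] VE] /asboolP[B [BBT dB] WE].
apply/asboolP; exists (B *m A); last by rewrite WE VE trmx_mul mulmxA.
split; last by rewrite det_mulmx dA dB mulr1.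
by rewrite trmx_mul mulmxA -(mulmxA B) AAT mulmx1.
Qed.

Definition orbit_equiv : equiv_rel (Conf N theta) :=
  EquivRel (@same_orbit R N theta)
    same_orbit_refl same_orbit_sym same_orbit_trans.

End SameOrbitEquiv.

Definition BConf (R : realType) (N : nat) (theta : R) : topologicalType :=
  quotient_topology {eq_quot (@orbit_equiv R N theta)}.

(* Angular distance between the contact points of two mutually tangent spheres
   of radius r that touch the central unit sphere. *)
Definition touching_angle (R : realType) (r : R) : R := 2 * asin (r / (1 + r)).

Lemma touching_angleE (R : realType) (r : R) : 0 <= r ->
  sin (touching_angle r / 2) = r / (1 + r).
Proof.
move=> r0; have r1 : 0 < 1 + r by rewrite ltr_pwDl.
rewrite /touching_angle mulrC mulKf ?pnatr_eq0 // asinK // in_itv /=.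
apply/andP; split; first by rewrite (le_trans (lerN10 R)) // divr_ge0 // ltW.
by rewrite ler_pdivrMr // mul1r lerDr.
Qed.

Definition BConf_radius (R : realType) (N : nat) (r : R) : topologicalType :=
  BConf N (touching_angle r).

Definition is_max_radius (R : realType) (N : nat) (r : R) : Prop :=
  [/\ 0 < r,
      [set: BConf_radius N r] !=set0 &
      forall s : R, 0 < s -> [set: BConf_radius N s] !=set0 -> s <= r].

Definition homeomorphic (X Y : topologicalType) : Prop :=
  exists (f : X -> Y) (g : Y -> X),
    [/\ continuous f, continuous g, cancel f g & cancel g f].

(* Finite simplicial complex with vertex set 'I_n, given by its nonempty
   simplices. *)
Definition simplicial_complex (n : nat) (K : {set {set 'I_n}}) : Prop :=
  [/\ finset.set0 \notin K,
      forall i : 'I_n, [set i]%SET \in K &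
      forall s t : {set 'I_n},
        s \in K -> t \subset s -> t != finset.set0 -> t \in K].

Definition complex_dim (n : nat) (K : {set {set 'I_n}}) : nat :=
  \max_(s in K) #|s|.-1.

Definition euler_char (n : nat) (K : {set {set 'I_n}}) : int :=
  \sum_(s in K) (-1) ^+ #|s|.-1.

(* Barycentric coordinates whose support is a simplex of K. *)
Definition realization_set (R : realType) (n : nat) (K : {set {set 'I_n}}) :
    set 'rV[R]_n :=
  [set x | [/\ forall i : 'I_n, 0 <= x 0 i,
               \sum_(i < n) x 0 i = 1 &
               [set i : 'I_n | x 0 i != 0]%SET \in K]].

Arguments realization_set R {n} K.

Definition realization (R : realType) (n : nat) (K : {set {set 'I_n}}) :
    topologicalType :=
  set_type (realization_set R K).

Definition contractible (R : realType) (X : topologicalType) : Prop :=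
  exists (c : X) (H : X * R -> X),
    [/\ {within [set: X] `*` `[0, 1], continuous H},
        forall x, H (x, 0) = x &
        forall x, H (x, 1) = c].

Definition connected_components (X : topologicalType) : set (set X) :=
  [set connected_component [set: X] x | x in [set: X]].

Arguments connected_components X : clear implicits.

(* Main.v *)
Require Import Defs.
From mathcomp Require Import all_boot all_order all_algebra generic_quotient.
From mathcomp Require Import ring lra.
From mathcomp Require Import all_classical all_reals all_analysis.

Set Implicit Arguments.
Unset Strict Implicit.
Unset Printing Implicit Defensive.

Import Order.TTheory GRing.Theory Num.Theory.
Import numFieldNormedType.Exports.

Local Open Scope classical_set_scope.
Local Open Scope quotient_scope.
Local Open Scope ring_scope.

(** Five points of the sphere with pairwise angles at least pi / 2 are five unit
    vectors of a 3-dimensional space with pairwise nonpositive dot products.  Such a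
    family consists of two opposite vectors, the poles, and three vectors of the
    orthogonal plane, on the equator ([obtuse_antipodal], [obtuse_normal_form]).  As
    poles and equator are orthogonal, no larger angle is possible, which gives the
    maximal radius.

    The three gaps between neighbors on the equator are at least pi / 2 and add up to
    2 pi.  So, modulo rotation, the configurations with given poles and a given
    cyclic order of the other points form a closed triangle; there are 10 choices of
    the poles and 2 orders, hence 20 triangles.  A corner of a triangle is a
    configuration in which one gap is a half turn.  Then a second pair is
    antipodal and can equally well serve as the poles, so two triangles
    meet there.  They meet nowhere else: the space has 30 vertices, 60 edges and 20
    triangles, and its Euler characteristic is 30 - 60 + 20 = -10.

    The homeomorphism onto the complex is given by explicit barycentric coordinates.
    Let a, b, c be minus the cosines of the gaps.  They are nonnegative and satisfy
    a^2 + b^2 + c^2 + 2 a b c = 1 ([standard_surface]), a surface that each ray of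
    the octant meets exactly once ([surface_radial], [surface_scale]); so they can
    be replaced by their ratios to a + b + c.  The function [weight] expresses
    them, for all the triangles at once, as continuous functions of the
    configuration.  The coordinates determine the configuration up to rotation
    ([bary_same_orbit]) and take all values ([bary_surj]), and a continuous bijection
    from a compact space to a Hausdorff space is a homeomorphism.

    The complex is connected because chains of triangles join all its vertices.  It is not contractible
    because it maps to the plane minus the origin in such a way that some loop of
    triangles winds once around the origin.  Instead of winding numbers, the proof
    uses square roots of complex numbers: on a compact contractible space every
    nowhere zero planar map has a continuous square root
    ([contractible_has_sqrt]), but this map has none ([wind_no_sqrt]).

    The facts about the finite incidence structure (which labelings give which corner
    or triangle, how triangles meet) are decided by computation on tables. *)

(** * Labelings, triangles and vertices *)

(** A list [:: i; j; k; l; m] is read as: the points i and j are the poles, and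
    k, l, m follow one another around the equator, counterclockwise seen from i. *)
Definition labelings : seq (seq nat) := Eval vm_compute in permutations (iota 0 5).

(** At a corner of a triangle k and l are antipodal as well, i, j, k, l span a
    square and m lies on its axis; the reading is then ambiguous, and this map
    turns the square by a quarter about m.  It has order 4. *)
Definition quarter (q : seq nat) : seq nat :=
  if q is [:: i; j; k; l; m] then [:: k; l; j; i; m] else q.

Definition turn (q : seq nat) : seq nat :=
  if q is [:: i; j; k; l; m] then [:: i; j; l; m; k] else q.

(** The readings of one corner configuration. *)
Definition quarters q := [:: q; quarter q; quarter (quarter q); quarter (quarter (quarter q))].

(** In each orbit of [quarter], the representative that begins with the least of
    its first four entries: 120 / 4 = 30 of them. *)
Definition vertices : seq (seq nat) := Eval vm_compute in
  [seq q <- labelings | all (leq (nth 0 q 0)) [:: nth 0 q 1; nth 0 q 2; nth 0 q 3]].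

Definition vertex n := nth [::] vertices n.

Definition vertex_index q := find (fun v => v \in quarters q) vertices.

(** The corners of the triangle of readings q: the gap between k and l, between l
    and m, or between m and k is a half turn. *)
Definition corners q := [:: vertex_index q; vertex_index (turn q); vertex_index (turn (turn q))].

(** The six readings of a configuration that has no second antipodal pair (cyclic
    shifts of k, l, m, and exchange of the poles with reversal of the equator) give
    the same sorted corners, which leaves 120 / 6 = 20 triangles. *)
Definition triangles : seq (seq nat) := Eval vm_compute in
  undup [seq sort leq (corners q) | q <- labelings].

(** One step of breadth-first search from s along the triangles of ts. *)
Definition grow (ts : seq (seq nat)) (s : seq nat) :=
  undup (s ++ flatten [seq t <- ts | has (mem s) t]).

Definition id5 := iota 0 5.

(* Tactic unification must compare the tables by name, not by content. *)
Opaque vertex_index labelings vertices triangles.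

Lemma labeling_perm p : (p \in labelings) = perm_eq p id5.
Proof.
have -> : labelings = permutations id5 by vm_compute.
by rewrite mem_permutations.
Qed.

Lemma size_labeling p : p \in labelings -> size p = 5%N.
Proof. by rewrite labeling_perm => /perm_size ->. Qed.

Lemma labelingP p : p \in labelings ->
  exists i j k l m, p = [:: i; j; k; l; m].
Proof.
by move/size_labeling; case: p => [|i [|j [|k [|l [|m []]]]]] // _; exists i, j, k, l, m.
Qed.

(** Relabeling by p^-1 reduces every weight of a configuration read by p to a
    weight of the configuration read by the identity labeling; r is the relabeled
    vertex and v its representative in the table. *)
Lemma vertex_in_triangle :
  all (fun p => all (fun n =>
    let r := map (index^~ p) (vertex n) in let v := vertex (vertex_index r) in
    [&& r \in labelings, map (nth 0 p) r == vertex n, v \in quarters r, v \in vertices,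
      (n == vertex_index p) == (v == [:: 0; 1; 2; 3; 4]),
      (n == vertex_index (turn p)) == (v == [:: 0; 1; 3; 4; 2]) &
      (n == vertex_index (turn (turn p))) == (v == [:: 0; 1; 4; 2; 3])]) (iota 0 30)) labelings.
Proof. by vm_compute. Qed.

(** The last two conditions say that the two triangles at a corner of p have no
    other corner in common. *)
Lemma labelings_closed : all (fun p =>
  [&& turn p \in labelings, quarter p \in labelings,
      quarter (quarter (quarter (quarter p))) == p, uniq (corners p),
      all (ltn^~ 30) (corners p), sort leq (corners p) \in triangles,
      vertex_index (turn p) \notin corners (quarter p) &
      vertex_index (turn (turn p)) \notin corners (quarter p)])%N labelings.
Proof. by vm_compute. Qed.

Lemma vertex_index_quarters : all (fun p => all (fun q =>
  (vertex_index q == vertex_index p) ==> (q \in quarters p)) labelings) labelings.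
Proof. by vm_compute. Qed.

Lemma turn_labeling p : p \in labelings -> turn p \in labelings.
Proof. by move=> /(allP labelings_closed)/and5P[]. Qed.

Lemma quarter_labeling p : p \in labelings -> quarter p \in labelings.
Proof. by move=> /(allP labelings_closed)/and5P[]. Qed.

Lemma quarterK p : p \in labelings -> quarter (quarter (quarter (quarter p))) = p.
Proof. by move=> /(allP labelings_closed)/and5P[_ _ /eqP]. Qed.

Lemma corners_uniq p : p \in labelings -> uniq (corners p).
Proof. by move=> /(allP labelings_closed)/and5P[_ _ _ +]. Qed.

Lemma corners_lt p n : p \in labelings -> n \in corners p -> (n < 30)%N.
Proof. by move=> /(allP labelings_closed)/and5P[_ _ _ _ /and4P[/allP + _ _ _]]; apply. Qed.

Lemma corners_triangles p : p \in labelings -> sort leq (corners p) \in triangles.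
Proof. by move=> /(allP labelings_closed)/and5P[_ _ _ _ /and4P[]]. Qed.

Lemma corners_quarter p : p \in labelings ->
  (vertex_index (turn p) \notin corners (quarter p)) &&
  (vertex_index (turn (turn p)) \notin corners (quarter p)).
Proof. by move=> /(allP labelings_closed)/and5P[_ _ _ _ /and4P[_ _ -> ->]]. Qed.

Lemma vertex_index_eq p q : p \in labelings -> q \in labelings -> vertex_index q = vertex_index p ->
  q \in quarters p.
Proof.
by move=> pl ql /eqP E; have := allP (allP vertex_index_quarters p pl) q ql; rewrite E.
Qed.

Lemma vertex_perm n : (n < 30)%N -> perm_eq (vertex n) id5.
Proof.
move=> n30; rewrite -labeling_perm.
have sv : size vertices = 30%N by vm_compute.
have /allP vl : all (mem labelings) vertices by vm_compute.
by apply: vl; apply: mem_nth; rewrite sv.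
Qed.

Lemma triangles_corners t : t \in triangles -> exists2 p, p \in labelings & t =i corners p.
Proof.
have -> : triangles = undup [seq sort leq (corners q) | q <- labelings] by vm_compute.
rewrite mem_undup => /mapP[p pl ->]; exists p => // i.
by rewrite mem_sort.
Qed.

Lemma triangles_size : all (fun t : seq nat =>
  [&& uniq t, all (ltn^~ 30%N) t & size t == 3%N]) triangles.
Proof. by vm_compute. Qed.

Lemma triangles_uniq : uniq triangles.
Proof. by vm_compute. Qed.

Lemma triangles_meet : all (fun t : seq nat => all (fun t' : seq nat => (t != t') ==>
  (size [seq i <- t | i \in t'] <= 1)%N) triangles) triangles.
Proof. by vm_compute. Qed.

Lemma triangles_cover : all (fun i => has (fun t : seq nat => i \in t) triangles) (iota 0 30).
Proof. by vm_compute. Qed.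

Lemma grow_all : all (fun n => n \in iter 6 (grow triangles) [:: 0%N]) (iota 0 30).
Proof. by vm_compute. Qed.

(** Both the connectedness of the complex and the constancy of a sign along a chain
    of triangles are instances of this induction. *)
Lemma grow_ind (P : nat -> Prop) (ts : seq (seq nat)) (a n : nat) :
  P a -> (forall (t : seq nat) (b c : nat), t \in ts -> b \in t -> c \in t -> P b -> P c) ->
  forall b : nat, b \in iter n (grow ts) [:: a] -> P b.
Proof.
move=> Pa step; elim: n => [|n IH] b; first by rewrite inE => /eqP ->.
rewrite /= mem_undup mem_cat => /orP[/IH //|/flattenP[t]].
rewrite mem_filter => /andP[/hasP[c ct /= cs] tT] bt; exact: step tT ct bt (IH c cs).
Qed.

(** The triangle [:: 5; 8; 14] heads the table.  Each other triangle has at most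
    one corner in common with it, so a nonzero difference of its three coordinates
    cannot be compensated there. *)
Lemma other_triangles : all (fun t : seq nat => (t \in triangles) &&
  (count (fun i => i \in t) [:: 5; 8; 14] <= 1)%N) (behead triangles).
Proof. by vm_compute. Qed.

Lemma trianglesE : triangles = [:: 5; 8; 14]%N :: behead triangles.
Proof. by vm_compute. Qed.

Lemma cut_triangle : [:: 5; 8; 14]%N \in triangles.
Proof. by rewrite trianglesE inE eqxx. Qed.

(** The corners 5 and 14 of the first triangle are also joined by a chain of other
    triangles; together with the first triangle the chain closes up to a loop. *)
Lemma grow_around : (14 \in iter 6 (grow (behead triangles)) [:: 5])%N.
Proof. by vm_compute. Qed.

(** * Vectors of the sphere with pairwise nonpositive dot products *)

Section Vectors.
Variable R : realType.
Implicit Types a b c d e u v w : 'rV[R]_3.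

Lemma dotvE u v :
  dotv u v = u 0 0 * v 0 0 + u 0 1 * v 0 1 + u 0 (2%:R) * v 0 (2%:R).
Proof.
rewrite /dotv !mxE !big_ord_recl big_ord0 !mxE addr0 addrA.
by congr (_ * _ + _ * _ + _ * _); congr (_ 0 _); apply/val_inj.
Qed.

Lemma dotvC u v : dotv u v = dotv v u.
Proof. by rewrite !dotvE; ring. Qed.

Lemma dotvNl u v : dotv (- u) v = - dotv u v.
Proof. by rewrite !dotvE !mxE; ring. Qed.

Lemma dotvNr u v : dotv u (- v) = - dotv u v.
Proof. by rewrite dotvC dotvNl dotvC. Qed.

Lemma dotv_eq0 u : dotv u u = 0 -> u = 0.
Proof.
rewrite dotvE => u0; apply/rowP => i; rewrite mxE; apply/eqP.
have [x0 y0 z0] : [/\ u 0 0 = 0, u 0 1 = 0 & u 0 (2%:R) = 0] by split; nra.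
case: i => -[|[|[|//]]] lei; apply/eqP.
- by rewrite -[RHS]x0; congr (u 0 _); apply/val_inj.
- by rewrite -[RHS]y0; congr (u 0 _); apply/val_inj.
- by rewrite -[RHS]z0; congr (u 0 _); apply/val_inj.
Qed.

Definition det3 a b c : R :=
  a 0 0 * (b 0 1 * c 0 2%:R - b 0 2%:R * c 0 1)
  - a 0 1 * (b 0 0 * c 0 2%:R - b 0 2%:R * c 0 0)
  + a 0 2%:R * (b 0 0 * c 0 1 - b 0 1 * c 0 0).

Lemma det3_turn a b c : det3 a b c = det3 b c a.
Proof. by rewrite /det3; ring. Qed.

Lemma det3_swap a b c : det3 a c b = - det3 a b c.
Proof. by rewrite /det3; ring. Qed.

Lemma det3Nl a b c : det3 (- a) b c = - det3 a b c.
Proof. by rewrite /det3 !mxE; ring. Qed.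

(** The Gram determinant, in its polarized form. *)
Lemma det3M a b c u v w : det3 a b c * det3 u v w =
  dotv a u * (dotv b v * dotv c w - dotv b w * dotv c v)
  - dotv a v * (dotv b u * dotv c w - dotv b w * dotv c u)
  + dotv a w * (dotv b u * dotv c v - dotv b v * dotv c u).
Proof. rewrite !dotvE /det3. ring. Qed.

(** Cramer's rule for the expansion of d in terms of a, b, c, paired with e.  With
    d = e = u it shows that three vectors orthogonal to a unit vector u are
    linearly dependent. *)
Lemma cramer3 a b c d e : dotv d e * det3 a b c =
  dotv a e * det3 d b c + dotv b e * det3 a d c + dotv c e * det3 a b d.
Proof. by rewrite !dotvE /det3; ring. Qed.

Lemma unit_dotvN1 u v : dotv u u = 1 -> dotv v v = 1 -> dotv u v = -1 -> v = - u.
Proof.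
move=> uu vv uv; apply/eqP; rewrite -addr_eq0; apply/eqP/dotv_eq0.
move: uu vv uv; rewrite !dotvE !mxE => *; nra.
Qed.

Lemma unit_dotv_bound u v : dotv u u = 1 -> dotv v v = 1 -> -1 <= dotv u v <= 1.
Proof.
move=> uu vv.
have p : 0 <= dotv (u + v) (u + v).
  by rewrite dotvE; apply: addr_ge0; [apply: addr_ge0|]; rewrite -expr2 sqr_ge0.
have m : 0 <= dotv (u - v) (u - v).
  by rewrite dotvE; apply: addr_ge0; [apply: addr_ge0|]; rewrite -expr2 sqr_ge0.
move: p m uu vv; rewrite !dotvE !mxE => *; apply/andP; split; lra.
Qed.

Definition obtuse (u : nat -> 'rV[R]_3) :=
  (forall n, (n < 5)%N -> dotv (u n) (u n) = 1) /\
  (forall m n, (m < 5)%N -> (n < 5)%N -> m != n -> dotv (u m) (u n) <= 0).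

(** Expanded by [det3M], the product is a sum of five terms, each nonpositive
    because of the signs of the dot products.  Consequently, among three points
    at most one lies strictly on each side of the plane spanned by two others. *)
Lemma obtuse_det3M_le0 a b c d :
  dotv a a = 1 -> dotv b b = 1 -> dotv a b <= 0 -> dotv c a <= 0 -> dotv c b <= 0 ->
  dotv d a <= 0 -> dotv d b <= 0 -> dotv c d <= 0 ->
  det3 c a b * det3 d a b <= 0.
Proof.
move=> aa bb ab ca cb da db cd; rewrite det3M aa bb.
rewrite (dotvC a d) (dotvC b d) (dotvC b a).
have /andP[ab1 _] := unit_dotv_bound aa bb.
set x := dotv a b in ab ab1 *; set y := dotv c a in ca *; set z := dotv c b in cb *.
set y' := dotv d a in da *; set z' := dotv d b in db *; set t := dotv c d in cd *.
have H1 : t * (1 - x * x) <= 0 by apply: mulr_le0_ge0; nra.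
have H2 : 0 <= y * y' by nra.
have H3 : 0 <= z * z' by nra.
have H4 : y * z' * x <= 0 by apply: mulr_ge0_le0; nra.
have H5 : z * y' * x <= 0 by apply: mulr_ge0_le0; nra.
nra.
Qed.

Lemma sqr1_le0 (x : R) : x * x = 1 -> x <= 0 -> x = -1.
Proof. by move=> *; nra. Qed.

(** If c lies in the plane of a and b, the products of [obtuse_det3M_le0] vanish,
    hence so do all five of their terms.  The resulting equations leave two cases:
    an antipodal pair among a, b, c, or d and e both normal to the plane, which
    makes them opposite. *)
Lemma coplanar_antipodal a b c d e :
  dotv a a = 1 -> dotv b b = 1 -> dotv c c = 1 -> dotv d d = 1 -> dotv e e = 1 ->
  dotv a b <= 0 -> dotv c a <= 0 -> dotv c b <= 0 ->
  dotv d a <= 0 -> dotv d b <= 0 -> dotv c d <= 0 ->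
  dotv e a <= 0 -> dotv e b <= 0 -> dotv c e <= 0 -> dotv d e <= 0 ->
  det3 c a b = 0 ->
  [\/ dotv a b = -1, dotv c a = -1, dotv c b = -1 | dotv d e = -1].
Proof.
move=> aa bb cc dd ee.
have := det3M c a b c a b; have := det3M c a b d a b; have := det3M c a b e a b.
have := det3M d a b e a b; have := det3M d a b d a b; have := det3M e a b e a b.
have /andP[+ _] := unit_dotv_bound aa bb.
rewrite aa bb cc dd ee (dotvC a d) (dotvC b d) (dotvC b a) (dotvC a e) (dotvC b e).
rewrite (dotvC a c) (dotvC b c).
set ab := dotv a b; set ca := dotv c a; set cb := dotv c b.
set da := dotv d a; set db := dotv d b; set cd := dotv c d.
set ea := dotv e a; set eb := dotv e b; set ce := dotv c e; set de := dotv d e.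
move=> ab1 E1 E2 E3 E4 E5 E6 ab0 ca0 cb0 da0 db0 cd0 ea0 eb0 ce0 de0 d0.
rewrite d0 !mul0r in E4 E5 E6.
(* The five summands of the expanded determinant are nonpositive with sum 0. *)
have split0 t y z : t <= 0 -> y <= 0 -> z <= 0 ->
    0 = t * (1 * 1 - ab * ab) - ca * (y * 1 - ab * z) + cb * (y * ab - 1 * z) ->
    [/\ ca * y = 0, cb * z = 0, ca * ab * z = 0 & cb * y * ab = 0].
  move=> t0 y0 z0 E.
  have H1 : t * (1 * 1 - ab * ab) <= 0 by apply: mulr_le0_ge0; nra.
  have H2 : 0 <= ca * y by nra.
  have H3 : 0 <= cb * z by nra.
  have H4 : ca * ab * z <= 0 by apply: mulr_ge0_le0; nra.
  have H5 : cb * y * ab <= 0 by apply: mulr_ge0_le0; nra.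
  by split; nra.
have [P1 P2 P3 P4] := split0 _ _ _ cd0 da0 db0 E5.
have [Q1 Q2 Q3 Q4] := split0 _ _ _ ce0 ea0 eb0 E4.
have [abN1|abN1] := eqVneq (ab * ab) 1; first by constructor 1; exact: sqr1_le0.
(* Two unit vectors normal to the independent vectors a and b are parallel. *)
have fin : da = 0 -> db = 0 -> ea = 0 -> eb = 0 -> de = -1.
  move=> da_0 db_0 ea_0 eb_0; apply: sqr1_le0 => //.
  rewrite da_0 db_0 ea_0 eb_0 in E1 E2 E3.
  have E : (1 - ab * ab) * (1 - ab * ab) * (de * de - 1) = 0.
    set p := det3 d a b in E2 E3; set q := det3 e a b in E1 E3.
    have : (p * q) * (p * q) = (p * p) * (q * q) by ring.
    by rewrite E1 E2 E3; nra.
  move/eqP: E; rewrite !mulf_eq0 !subr_eq0 orbb ![1 == _]eq_sym (negPf abN1) /=.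
  by move/eqP.
have [ca_0|ca_0] := eqVneq ca 0; have [cb_0|cb_0] := eqVneq cb 0.
- rewrite ca_0 cb_0 in E6; by case/eqP: abN1; nra.
- move: P2 P4 Q2 Q4 => /eqP + /eqP + /eqP + /eqP; rewrite !mulf_eq0 (negPf cb_0) /=.
  have [ab_0|ab_0] := eqVneq ab 0.
    by move=> *; constructor 3; apply: sqr1_le0 => //; rewrite ca_0 ab_0 in E6; nra.
  by rewrite !orbF => /eqP ? /eqP ? /eqP ? /eqP ?; constructor 4; apply: fin.
- move: P1 P3 Q1 Q3 => /eqP + /eqP + /eqP + /eqP; rewrite !mulf_eq0 (negPf ca_0) /=.
  have [ab_0|ab_0] := eqVneq ab 0.
    by move=> *; constructor 2; apply: sqr1_le0 => //; rewrite cb_0 ab_0 in E6; nra.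
  by move=> /eqP ? /eqP ? /eqP ? /eqP ?; constructor 4; apply: fin.
- move: P1 P2 Q1 Q2 => /eqP + /eqP + /eqP + /eqP; rewrite !mulf_eq0.
  rewrite (negPf ca_0) (negPf cb_0) /=.
  by move=> /eqP ? /eqP ? /eqP ? /eqP ?; constructor 4; apply: fin.
Qed.

(** Relative to the plane of the points 3 and 4, two of the points 0, 1, 2 would
    lie strictly on the same side if none of them were in the plane; that
    contradicts [obtuse_det3M_le0].  So some three points are coplanar with the
    origin and [coplanar_antipodal] applies. *)
Lemma obtuse_antipodal (u : nat -> 'rV[R]_3) : obtuse u ->
  exists m n, [/\ (m < 5)%N, (n < 5)%N, m != n & dotv (u m) (u n) = -1].
Proof.
move=> [u1 u0].
have key (a b c d e : nat) : all (ltn^~ 5%N) [:: a; b; c; d; e] -> uniq [:: a; b; c; d; e] ->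
  det3 (u c) (u a) (u b) = 0 ->
  exists m n, [/\ (m < 5)%N, (n < 5)%N, m != n & dotv (u m) (u n) = -1].
  move=> /= /and5P[a5 b5 c5 d5 /andP[e5 _]].
  rewrite !inE !negb_or => /and5P[/and4P[ab ac ad ae] /and3P[bc bd be] /andP[cd ce] de _].
  case/(@coplanar_antipodal _ _ _ (u d) (u e)); rewrite ?u1 ?u0 // 1?eq_sym // => E.
  - by exists a, b.
  - by exists c, a; rewrite eq_sym.
  - by exists c, b; rewrite eq_sym.
  - by exists d, e.
have s01 := @obtuse_det3M_le0 (u 3%N) (u 4%N) (u 0%N) (u 1%N).
have s02 := @obtuse_det3M_le0 (u 3%N) (u 4%N) (u 0%N) (u 2%N).
have s12 := @obtuse_det3M_le0 (u 3%N) (u 4%N) (u 1%N) (u 2%N).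
rewrite !u1 // !u0 // in s01 s02 s12.
have {}s01 := s01 erefl erefl erefl erefl erefl erefl erefl erefl.
have {}s02 := s02 erefl erefl erefl erefl erefl erefl erefl erefl.
have {}s12 := s12 erefl erefl erefl erefl erefl erefl erefl erefl.
have [d0|x0] := eqVneq (det3 (u 0%N) (u 3%N) (u 4%N)) 0.
  exact: (key 3%N 4%N 0%N 1%N 2%N).
have [d0|y0] := eqVneq (det3 (u 1%N) (u 3%N) (u 4%N)) 0.
  exact: (key 3%N 4%N 1%N 0%N 2%N).
have [d0|z0] := eqVneq (det3 (u 2%N) (u 3%N) (u 4%N)) 0.
  exact: (key 3%N 4%N 2%N 0%N 1%N).
move: s01 s02 s12 x0 y0 z0.
set x := det3 _ _ _; set y := det3 _ _ _; set z := det3 _ _ _.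
by case: (ltrgtP x 0); case: (ltrgtP y 0); case: (ltrgtP z 0) => // *; nra.
Qed.
End Vectors.

(** * Poles, equator and weights *)

Section Config.
Variable R : realType.
Implicit Types u : nat -> 'rV[R]_3.

Definition relabel u (p : seq nat) : nat -> 'rV[R]_3 := fun n => u (nth 0%N p n).

Lemma obtuse_relabel u p : p \in labelings -> obtuse u -> obtuse (relabel u p).
Proof.
move=> pl [u1 u0]; have sp := size_labeling pl.
move: pl; rewrite labeling_perm => pp.
have lt5 n : (n < 5)%N -> (nth 0%N p n < 5)%N.
  move=> n5; have : nth 0%N p n \in p by rewrite mem_nth ?sp.
  by rewrite (perm_mem pp) mem_iota.
split=> [n n5|m n m5 n5 mn]; first by rewrite /relabel u1 ?lt5.
rewrite /relabel u0 ?lt5 // nth_uniq ?sp //.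
by rewrite (perm_uniq pp) iota_uniq.
Qed.

(** The reading of u by the identity labeling is correct: poles 0 and 1, and the
    points 2, 3, 4 in this order around the equator. *)
Definition standard u :=
  [/\ u 1%N = - u 0%N,
      [/\ dotv (u 0%N) (u 2%N) = 0, dotv (u 0%N) (u 3%N) = 0 & dotv (u 0%N) (u 4%N) = 0] &
      [/\ 0 <= det3 (u 0%N) (u 2%N) (u 3%N), 0 <= det3 (u 0%N) (u 3%N) (u 4%N) &
          0 <= det3 (u 0%N) (u 4%N) (u 2%N)]].

(** A point has nonpositive dot products with both of two opposite vectors, so it
    is orthogonal to them.  By [det3M] the three oriented areas have pairwise
    nonnegative products, so they have a common sign; if it is negative, two
    equatorial points are exchanged. *)
Lemma poles_normal_form u p : obtuse u -> p \in labelings ->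
  dotv (u (nth 0%N p 0)) (u (nth 0%N p 1)) = -1 ->
  exists2 p', p' \in labelings & standard (relabel u p').
Proof.
move=> uo pl; case: (labelingP pl) => i [j [k [l [m pE]]]]; rewrite pE /= => ij.
have [v1 v0] := obtuse_relabel pl uo; rewrite {}pE in pl v1 v0.
have pl' : [:: i; j; k; m; l] \in labelings.
  move: pl; rewrite !labeling_perm; apply: perm_trans.
  by rewrite (perm_cat2l [:: i; j; k]) (perm_catC [:: m] [:: l]).
rewrite /relabel in v1 v0.
have ii := v1 0%N erefl; have jj := v1 1%N erefl; have kk := v1 2%N erefl.
have ll := v1 3%N erefl; have mm := v1 4%N erefl.
have ik := v0 0%N 2%N erefl erefl erefl; have il := v0 0%N 3%N erefl erefl erefl.
have im := v0 0%N 4%N erefl erefl erefl; have jk := v0 1%N 2%N erefl erefl erefl.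
have jl := v0 1%N 3%N erefl erefl erefl; have jm := v0 1%N 4%N erefl erefl erefl.
have kl := v0 2%N 3%N erefl erefl erefl; have lm := v0 3%N 4%N erefl erefl erefl.
have mk := v0 4%N 2%N erefl erefl erefl.
rewrite /= in ii jj kk ll mm ik il im jk jl jm kl lm mk.
have jE := unit_dotvN1 ii jj ij.
rewrite jE !dotvNl in jk jl jm.
have ik0 : dotv (u i) (u k) = 0 by apply/eqP; rewrite eq_le ik -oppr_le0.
have il0 : dotv (u i) (u l) = 0 by apply/eqP; rewrite eq_le il -oppr_le0.
have im0 : dotv (u i) (u m) = 0 by apply/eqP; rewrite eq_le im -oppr_le0.
have S1 := det3M (u i) (u k) (u l) (u i) (u l) (u m).
have S2 := det3M (u i) (u l) (u m) (u i) (u m) (u k).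
have S3 := det3M (u i) (u m) (u k) (u i) (u k) (u l).
rewrite ?(dotvC (u k) (u i)) ?(dotvC (u l) (u i)) ?(dotvC (u m) (u i)) in S1 S2 S3.
rewrite ?(dotvC (u l) (u k)) ?(dotvC (u m) (u l)) ?(dotvC (u k) (u m)) in S1 S2 S3.
rewrite ?ii ?kk ?ll ?mm ?ik0 ?il0 ?im0 in S1 S2 S3.
have [n1|p1] := ltP (det3 (u i) (u k) (u l)) 0;
  have [n2|p2] := ltP (det3 (u i) (u l) (u m)) 0;
  have [n3|p3] := ltP (det3 (u i) (u m) (u k)) 0; try by exfalso; nra.
all: try by exists [:: i; j; k; l; m] => //; rewrite /standard /relabel /=; split.
all: exists [:: i; j; k; m; l] => //; rewrite /standard /relabel /=; split=> //.
all: rewrite ![det3 _ (u k) (u m)]det3_swap ![det3 _ (u m) (u l)]det3_swap.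
all: rewrite ![det3 _ (u l) (u k)]det3_swap; split; nra.
Qed.

Lemma obtuse_normal_form u : obtuse u ->
  exists2 p, p \in labelings & standard (relabel u p).
Proof.
move=> uo; have [i [j [i5 j5 ij E]]] := obtuse_antipodal uo.
have : has (fun p => (nth 0%N p 0 == i) && (nth 0%N p 1 == j)) labelings.
  move: i5 j5 ij {E}.
  by case: i => [|[|[|[|[|//]]]]]; case: j => [|[|[|[|[|//]]]]] // _ _ _; vm_compute.
case/hasP => p pl /andP[/eqP pi /eqP pj].
by apply: (poles_normal_form uo pl); rewrite pi pj.
Qed.

(** At the corner with reading q the product of dot products is 1.  It is
    nonzero only if one of the pairs q0 q1, q2 q3 is the pair of poles and the
    other is not orthogonal.  The second argument tests the orientation: it is 0
    for the wrong one, and for the right one it is so large (at least 1) that the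
    minimum is the product of the two dot products.  This way the sharp
    distinction of orientations is made by a continuous function. *)
Definition weight u (q : seq nat) : R :=
  let v n := u (nth 0%N q n) in
  Num.min (dotv (v 0%N) (v 1%N) * dotv (v 2%N) (v 3%N))
    (Num.max 0 (- det3 (v 0%N - v 1%N) (v 2%N - v 3%N) (v 4%N))).

(** The second argument of the minimum is antisymmetric in each of the two pairs
    and under their exchange, and [quarter] combines two of these operations. *)
Lemma weight_quarter u q : weight u (quarter q) = weight u q.
Proof.
case: q => [|i [|j [|k [|l [|m []]]]]] //; rewrite /weight /=.
congr (Num.min _ (Num.max 0 (- _))); first by rewrite mulrC (dotvC (u j)).
by rewrite /det3 !mxE; ring.
Qed.

Lemma weight_quarters u q r : r \in quarters q -> weight u r = weight u q.
Proof. by rewrite !inE => /or4P[] /eqP->; rewrite ?weight_quarter. Qed.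

Lemma weight_relabel u p r : size r = 5%N ->
  weight u (map (nth 0%N p) r) = weight (relabel u p) r.
Proof. by case: r => [|i [|j [|k [|l [|m []]]]]]. Qed.

(** The three sides are minus the cosines of the gaps between consecutive
    equatorial points; a side is 0 for a right angle and 1 for a half turn. *)
Definition side1 u : R := - dotv (u 2%N) (u 3%N).
Definition side2 u : R := - dotv (u 3%N) (u 4%N).
Definition side3 u : R := - dotv (u 4%N) (u 2%N).

Lemma sides_ge0 u : obtuse u -> [/\ 0 <= side1 u, 0 <= side2 u & 0 <= side3 u].
Proof. by move=> [_ u0]; rewrite /side1 /side2 /side3 !oppr_ge0 !u0. Qed.

(** The three equatorial points are linearly dependent, so their Gram determinant
    vanishes. *)
Lemma standard_surface u : obtuse u -> standard u ->
  side1 u ^+ 2 + side2 u ^+ 2 + side3 u ^+ 2 + 2 * side1 u * side2 u * side3 u = 1.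
Proof.
move=> [u1 _] [_ [z2 z3 z4] _].
have := cramer3 (u 2%N) (u 3%N) (u 4%N) (u 0%N) (u 0%N).
rewrite (dotvC (u 2%N) (u 0%N)) (dotvC (u 3%N) (u 0%N)) (dotvC (u 4%N) (u 0%N)).
rewrite z2 z3 z4 (u1 0%N) // !mul0r !addr0 mul1r => d0.
have := det3M (u 2%N) (u 3%N) (u 4%N) (u 2%N) (u 3%N) (u 4%N).
rewrite d0 mul0r !u1 // (dotvC (u 3%N) (u 2%N)) (dotvC (u 4%N) (u 3%N)).
rewrite (dotvC (u 2%N) (u 4%N)) /side1 /side2 /side3 => E; lra.
Qed.

Lemma standard_det_sqr u : obtuse u -> standard u ->
  [/\ det3 (u 0%N) (u 2%N) (u 3%N) ^+ 2 = 1 - side1 u ^+ 2,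
      det3 (u 0%N) (u 3%N) (u 4%N) ^+ 2 = 1 - side2 u ^+ 2 &
      det3 (u 0%N) (u 4%N) (u 2%N) ^+ 2 = 1 - side3 u ^+ 2].
Proof.
move=> [u1 _] [_ [z2 z3 z4] _]; rewrite !expr2 !det3M !u1 // z2 z3 z4.
rewrite (dotvC (u 3%N) (u 2%N)) (dotvC (u 4%N) (u 3%N)) (dotvC (u 2%N) (u 4%N)).
by rewrite /side1 /side2 /side3; split; ring.
Qed.

(** Of the 30 weights, 24 contain a dot product of a pole with an equatorial point
    and vanish.  The remaining six have 0 and 1 as first pair: three have the wrong
    orientation, the other three are the sides. *)
Lemma standard_weight u v : obtuse u -> standard u -> v \in vertices ->
  weight u v = if v == [:: 0; 1; 2; 3; 4]%N then side1 u
               else if v == [:: 0; 1; 3; 4; 2]%N then side2 u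
               else if v == [:: 0; 1; 4; 2; 3]%N then side3 u else 0.
Proof.
move=> uo us; have [s1 s2 s3] := sides_ge0 uo; have S := standard_surface uo us.
have [D1 D2 D3] := standard_det_sqr uo us.
have [u1 [z2 z3 z4] [d1 d2 d3]] := us.
have y2 := z2; have y3 := z3; have y4 := z4; rewrite dotvC in y2 y3 y4.
have u00 : dotv (u 0%N) (u 0%N) = 1 by case: uo => + _; apply.
have pole k l m : weight u [:: 0; 1; k; l; m]%N =
    Num.min (- dotv (u k) (u l)) (Num.max 0 (2 * det3 (u 0%N) (u l) (u m) - 2 * det3 (u 0%N) (u k) (u m))).
  rewrite /weight /= u1 dotvNr u00 mulN1r; congr (Num.min _ (Num.max 0 _)).
  by rewrite /det3 !mxE; ring.
have big (x y : R) : 0 <= x -> x <= y -> Num.min x (Num.max 0 y) = x.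
  by move=> x0 xy; rewrite min_l // le_max xy orbT.
have small (x y : R) : 0 <= x -> y <= 0 -> Num.min x (Num.max 0 y) = 0.
  by move=> x0 y0; rewrite max_l // min_r.
have zero (x : R) : Num.min 0 (Num.max 0 x) = 0 by rewrite min_l // le_max lexx.
(* The orientation test 2 p + 2 q dominates a: p^2 + q^2 = 2 - b^2 - c^2 >= 1. *)
have bound (a b c p q : R) : 0 <= a -> 0 <= b -> 0 <= c -> 0 <= p -> 0 <= q ->
    a ^+ 2 + b ^+ 2 + c ^+ 2 + 2 * a * b * c = 1 ->
    p ^+ 2 = 1 - b ^+ 2 -> q ^+ 2 = 1 - c ^+ 2 -> a <= 2 * p + 2 * q.
  move=> a0 b0 c0 p0 q0 E P Q.
  have abc : 0 <= a * b * c by rewrite !mulr_ge0.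
  have a1 : a <= 1 by rewrite -(@ler_pXn2r _ 2) ?nnegrE // expr1n; nra.
  have pq : 1 <= p + q.
    rewrite -(@ler_pXn2r _ 2) ?nnegrE ?addr_ge0 // expr1n.
    have : 0 <= p * q by rewrite mulr_ge0.
    nra.
  nra.
have b1 := bound _ _ _ _ _ s1 s2 s3 d2 d3 S D2 D3.
have b2 := bound _ _ _ _ _ s2 s3 s1 d3 d1 _ D3 D1.
have b3 := bound _ _ _ _ _ s3 s1 s2 d1 d2 _ D1 D2.
have {}b2 := b2 ltac:(apply: etrans S; ring).
have {}b3 := b3 ltac:(apply: etrans S; ring).
have -> : vertices = ltac:(let l := eval vm_compute in vertices in exact l) by vm_compute.
rewrite !inE.
have w0 := (z2, z3, z4, y2, y3, y4).
have sw := (det3_swap (u 0%N) (u 2%N) (u 3%N), det3_swap (u 0%N) (u 3%N) (u 4%N), det3_swap (u 0%N) (u 4%N) (u 2%N)).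
rewrite /side1 /side2 /side3 in s1 s2 s3 b1 b2 b3 *.
do 29?[case/predU1P => [->|]]; last move/eqP => ->.
all: rewrite /=.
all: try by rewrite /weight /= ?u1 ?dotvNl ?dotvNr ?w0 ?oppr0 ?mulr0 ?mul0r zero.
all: rewrite pole.
all: rewrite ?sw ?(dotvC (u 3%N) (u 2%N)) ?(dotvC (u 4%N) (u 3%N)) ?(dotvC (u 2%N) (u 4%N)).
all: try by apply: small => //; lra.
all: by apply: big => //; lra.
Qed.
End Config.

(** * Coordinates of a configuration *)

Section Coordinates.
Variable R : realType.
Implicit Types u : nat -> 'rV[R]_3.

Lemma triangle_weight u p n : obtuse u -> p \in labelings -> standard (relabel u p) ->
  (n < 30)%N ->
  weight u (vertex n) =
    if n == vertex_index p then side1 (relabel u p)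
    else if n == vertex_index (turn p) then side2 (relabel u p)
    else if n == vertex_index (turn (turn p)) then side3 (relabel u p) else 0.
Proof.
move=> uo pl us n30; have nI : n \in iota 0 30 by rewrite mem_iota.
have /and5P[rl /eqP rE vr vv /and3P[/eqP-> /eqP-> /eqP->]] :=
  allP (allP vertex_in_triangle p pl) n nI.
rewrite -(standard_weight (obtuse_relabel pl uo) us vv).
by rewrite (weight_quarters _ vr) -weight_relabel ?rE ?(size_labeling rl).
Qed.

Lemma sum_corners (T : nmodType) (a b c : nat) (x y z : T) : uniq [:: a; b; c] ->
  (a < 30)%N -> (b < 30)%N -> (c < 30)%N ->
  \sum_(n < 30) (if n == a :> nat then x else if n == b :> nat then y
                 else if n == c :> nat then z else 0) = x + y + z.
Proof.
rewrite /= !inE negb_or => /and3P[/andP[ab ac] bc _] a30 b30 c30.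
rewrite (bigD1 (Ordinal a30)) //= eqxx -addrA; congr (_ + _).
rewrite (bigD1 (Ordinal b30)) /=; last by rewrite -val_eqE /= eq_sym.
rewrite eq_sym (negPf ab) eqxx; congr (_ + _).
rewrite (bigD1 (Ordinal c30)) /=; last by rewrite -!val_eqE /= ![c == _]eq_sym ac.
rewrite ![c == _]eq_sym (negPf ac) (negPf bc) eqxx big1 ?addr0 // => i.
by rewrite -!val_eqE /= => /andP[/andP[/negPf-> /negPf->] /negPf->].
Qed.

Definition total u := \sum_(n < 30) weight u (vertex n).

Definition coords u : 'rV[R]_30 := \row_n (weight u (vertex n) / total u).

Lemma triangle_total u p : obtuse u -> p \in labelings -> standard (relabel u p) ->
  total u = side1 (relabel u p) + side2 (relabel u p) + side3 (relabel u p).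
Proof.
move=> uo pl us; have lt := corners_lt pl.
rewrite -(sum_corners _ _ _ (corners_uniq pl)) ?lt ?inE ?eqxx ?orbT //.
by apply: eq_bigr => n _; rewrite (triangle_weight uo pl us).
Qed.

Lemma surface_gt0 (a b c : R) : 0 <= a -> 0 <= b -> 0 <= c ->
  a ^+ 2 + b ^+ 2 + c ^+ 2 + 2 * a * b * c = 1 -> 0 < a + b + c.
Proof.
move=> a0 b0 c0 E; rewrite lt_neqAle !addr_ge0 // andbT eq_sym.
apply/eqP => s0; have [ea eb ec] : [/\ a = 0, b = 0 & c = 0] by split; lra.
by move: E; rewrite ea eb ec; lra.
Qed.

Lemma total_gt0 u : obtuse u -> 0 < total u.
Proof.
move=> uo; have [p pl us] := obtuse_normal_form uo.
have vo := obtuse_relabel pl uo; have [s1 s2 s3] := sides_ge0 vo.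
by rewrite (triangle_total uo pl us) surface_gt0 // standard_surface.
Qed.

Lemma standard_turn u p : p \in labelings -> standard (relabel u p) ->
  standard (relabel u (turn p)).
Proof.
move=> /labelingP[i [j [k [l [m ->]]]]]; rewrite /standard /relabel /=.
by move=> [-> [-> -> ->] [-> -> ->]].
Qed.

(** The poles are exchanged, and the equator, seen from the other pole, runs
    backwards. *)
Lemma standard_half u p : p \in labelings -> standard (relabel u p) ->
  standard (relabel u (quarter (quarter p))).
Proof.
move=> /labelingP[i [j [k [l [m ->]]]]]; rewrite /standard /relabel /=.
move=> [jE [ik il im] [d1 d2 d3]]; rewrite jE opprK !dotvNl ik il im oppr0.
by rewrite !det3Nl -!det3_swap.
Qed.

(** Two vanishing sides force the third one to be 1, that is, a second antipodal
    pair; it is orthogonal to everything else and can serve as the poles. *)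
Lemma standard_quarter u p : obtuse u -> p \in labelings -> standard (relabel u p) ->
  side2 (relabel u p) = 0 -> side3 (relabel u p) = 0 ->
  standard (relabel u (quarter p)).
Proof.
move=> uo pl us z2 z3; have vo := obtuse_relabel pl uo.
have S := standard_surface vo us; have [s1 _ _] := sides_ge0 vo.
have {S} s1E : side1 (relabel u p) = 1.
  have : (side1 (relabel u p)) ^+ 2 = 1 by rewrite -[RHS]S z2 z3; ring.
  by nra.
case: vo => v1 _; have := unit_dotvN1 (v1 2%N erefl) (v1 3%N erefl).
move: us z2 z3 s1E {v1 s1}; case/labelingP: pl => i [j [k [l [m ->]]]].
rewrite /standard /side1 /side2 /side3 /relabel /=.
move=> [jE [ik il im] [d1 d2 d3]] lm mk kl.
have -> : dotv (u k) (u l) = -1 by rewrite -kl opprK.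
move=> /(_ erefl) lE; rewrite lE; split=> //.
  by rewrite jE dotvNr dotvC ik dotvC -[dotv _ _]opprK mk !oppr0.
rewrite jE; split.
- by rewrite -det3_turn det3_swap /det3 !mxE le_eqVlt; apply/orP; left; apply/eqP; ring.
- by rewrite det3_turn.
- rewrite -det3_turn det3Nl -det3_swap //.
Qed.

(** The sides do not all vanish, and a cyclic shift moves any of them to the front. *)
Lemma normal_form_side1_gt0 u : obtuse u ->
  exists p, [/\ p \in labelings, standard (relabel u p) & 0 < side1 (relabel u p)].
Proof.
move=> uo; have [p pl us] := obtuse_normal_form uo.
have vo := obtuse_relabel pl uo; have [s1 s2 s3] := sides_ge0 vo.
have [p1|n1] := ltP 0 (side1 (relabel u p)); first by exists p.
have tl := turn_labeling pl; have ts := standard_turn pl us.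
have sE q : q \in labelings -> side1 (relabel u (turn q)) = side2 (relabel u q) /\
    side2 (relabel u (turn q)) = side3 (relabel u q).
  by move=> /labelingP[i [j [k [l [m ->]]]]]; split.
have [p2|n2] := ltP 0 (side2 (relabel u p)).
  by exists (turn p); split=> //; rewrite (sE _ pl).1.
exists (turn (turn p)); split; [exact: turn_labeling|exact: standard_turn|].
rewrite (sE _ tl).1 (sE _ pl).2 lt_neqAle s3 andbT eq_sym; apply/eqP => z3.
by have := total_gt0 uo; rewrite (triangle_total uo pl us) z3; lra.
Qed.

Lemma triangle_coord u p : obtuse u -> p \in labelings -> standard (relabel u p) ->
  forall n : 'I_30, coords u 0 n =
    (if n == vertex_index p :> nat then side1 (relabel u p)
    else if n == vertex_index (turn p) :> nat then side2 (relabel u p)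
    else if n == vertex_index (turn (turn p)) :> nat then side3 (relabel u p) else 0) / total u.
Proof. by move=> uo pl us n; rewrite mxE (triangle_weight uo pl us). Qed.

Lemma coord_neq0_corners u p (n : 'I_30) : obtuse u -> p \in labelings ->
  standard (relabel u p) -> coords u 0 n != 0 -> (n : nat) \in corners p.
Proof.
move=> uo pl us; rewrite (triangle_coord uo pl us) /corners !inE.
case: (_ =P vertex_index p) => // _; case: (_ =P vertex_index (turn p)) => // _.
by case: (_ =P vertex_index (turn (turn p))) => // _; rewrite mul0r eqxx.
Qed.

Lemma coord_gt0_normal_form u (n : 'I_30) : obtuse u -> coords u 0 n != 0 ->
  exists p, [/\ p \in labelings, standard (relabel u p) & vertex_index p = n].
Proof.
move=> uo n0; have [p pl us] := obtuse_normal_form uo.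
have := coord_neq0_corners uo pl us n0; rewrite !inE => /or3P[] /eqP nE.
- by exists p.
- by exists (turn p); rewrite turn_labeling //; split=> //; exact: standard_turn.
- exists (turn (turn p)); rewrite !turn_labeling //; split=> //.
  by do 2?apply: standard_turn => //; exact: turn_labeling.
Qed.

(** Choose a corner of u with nonzero coordinate and read both configurations from
    this corner.  The readings agree up to [quarter], that is, u and u' lie in the
    same triangle or in the two triangles that meet at the corner.  In the second
    case the other coordinates of u vanish, since u' has none there, and u itself
    is the corner configuration, which lies in both triangles. *)
Lemma coords_common_triangle u u' : obtuse u -> obtuse u' -> coords u = coords u' ->
  exists p, [/\ p \in labelings, standard (relabel u p) & standard (relabel u' p)].
Proof.
move=> uo uo' E; have [p [pl us s1]] := normal_form_side1_gt0 uo.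
have n30 : (vertex_index p < 30)%N by apply: (corners_lt pl); rewrite inE eqxx.
have [|p' [pl' us' iE]] := coord_gt0_normal_form (n := Ordinal n30) uo'.
  by rewrite -E (triangle_coord uo pl us) /= eqxx mulf_neq0 ?invr_neq0 // gt_eqF ?total_gt0.
have us2 := standard_half pl' us'.
have [usp|usq] : standard (relabel u' p) \/ standard (relabel u' (quarter p)).
  have := vertex_index_eq pl pl' iE; rewrite !inE => /or4P[] /eqP pE.
  - by left; rewrite -pE.
  - by right; rewrite -pE.
  - by left; rewrite pE quarterK in us2.
  - by right; rewrite pE quarterK ?quarter_labeling in us2.
- by exists p.
have ql := quarter_labeling pl.
exists (quarter p); split=> //.
have /andP[t1 t2] := corners_quarter pl; have := corners_uniq pl.
rewrite /= !inE negb_or => /and3P[/andP[ab ac] bc _].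
rewrite ![vertex_index p == _]eq_sym in ab ac; rewrite eq_sym in bc.
have lt := corners_lt pl.
have zero n : n \notin corners (quarter p) -> forall n30 : (n < 30)%N,
    coords u 0 (Ordinal n30) = 0.
  move=> nq n30'; rewrite E; apply/eqP; apply: contraNT nq.
  exact: coord_neq0_corners.
have tn0 : (total u)^-1 != 0 by rewrite invr_neq0 // gt_eqF ?total_gt0.
apply: standard_quarter => //.
- have m30 : (vertex_index (turn p) < 30)%N by apply: lt; rewrite !inE eqxx orbT.
  have /eqP := zero _ t1 m30; rewrite (triangle_coord uo pl us) /=.
  by rewrite (negPf ab) eqxx mulf_eq0 (negPf tn0) orbF => /eqP.
- have m30 : (vertex_index (turn (turn p)) < 30)%N by apply: lt; rewrite !inE eqxx !orbT.
  have /eqP := zero _ t2 m30; rewrite (triangle_coord uo pl us) /=.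
  by rewrite (negPf ac) (negPf bc) eqxx mulf_eq0 (negPf tn0) orbF => /eqP.
Qed.

(** On the nonnegative octant the left side of the equation is strictly increasing
    along each ray, so the surface meets each ray at most once. *)
Lemma surface_radial (a b c a' b' c' : R) :
  0 <= a -> 0 <= b -> 0 <= c -> 0 <= a' -> 0 <= b' -> 0 <= c' ->
  a ^+ 2 + b ^+ 2 + c ^+ 2 + 2 * a * b * c = 1 ->
  a' ^+ 2 + b' ^+ 2 + c' ^+ 2 + 2 * a' * b' * c' = 1 ->
  a / (a + b + c) = a' / (a' + b' + c') ->
  b / (a + b + c) = b' / (a' + b' + c') ->
  c / (a + b + c) = c' / (a' + b' + c') ->
  [/\ a = a', b = b' & c = c'].
Proof.
move=> a0 b0 c0 a'0 b'0 c'0 E E' ea eb ec.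
have s0 := surface_gt0 a0 b0 c0 E; have s'0 := surface_gt0 a'0 b'0 c'0 E'.
move: ea eb ec s0 s'0; set s := a + b + c; set s' := a' + b' + c' => ea eb ec s0 s'0.
set x := a / s in ea; set y := b / s in eb; set z := c / s in ec.
have aE : a = s * x by rewrite mulrC mulfVK ?gt_eqF.
have bE : b = s * y by rewrite mulrC mulfVK ?gt_eqF.
have cE : c = s * z by rewrite mulrC mulfVK ?gt_eqF.
have aE' : a' = s' * x by rewrite ea mulrC mulfVK ?gt_eqF.
have bE' : b' = s' * y by rewrite eb mulrC mulfVK ?gt_eqF.
have cE' : c' = s' * z by rewrite ec mulrC mulfVK ?gt_eqF.
have x0 : 0 <= x by apply: divr_ge0 => //; exact: ltW.
have y0 : 0 <= y by apply: divr_ge0 => //; exact: ltW.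
have z0 : 0 <= z by apply: divr_ge0 => //; exact: ltW.
suff sE : s = s' by rewrite aE bE cE aE' bE' cE' sE.
clearbody x y z s s'.
have Q : 0 < x ^+ 2 + y ^+ 2 + z ^+ 2.
  rewrite lt_neqAle !addr_ge0 ?sqr_ge0 // andbT eq_sym; apply/eqP => Q0.
  have [ex ey ez] : [/\ x = 0, y = 0 & z = 0] by split; nra.
  by move: E; rewrite aE bE cE ex ey ez; lra.
have T : 0 <= x * y * z by rewrite !mulr_ge0.
have : (s - s') * ((s + s') * (x ^+ 2 + y ^+ 2 + z ^+ 2)
    + 2 * (s ^+ 2 + s * s' + s' ^+ 2) * (x * y * z)) = 0.
  by move: E E'; rewrite aE bE cE aE' bE' cE' => E E'; nra.
move=> /eqP; rewrite mulf_eq0 subr_eq0 => /orP[/eqP //|].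
rewrite gt_eqF //; apply: ltr_wpDr; last by apply: mulr_gt0 => //; exact: addr_gt0.
apply: mulr_ge0 => //; apply: mulr_ge0 => //.
by rewrite addr_ge0 ?sqr_ge0 // addr_ge0 ?sqr_ge0 // ltW // mulr_gt0.
Qed.

Lemma coords_sides u u' p : obtuse u -> obtuse u' -> p \in labelings ->
  standard (relabel u p) -> standard (relabel u' p) -> coords u = coords u' ->
  [/\ side1 (relabel u p) = side1 (relabel u' p),
      side2 (relabel u p) = side2 (relabel u' p) &
      side3 (relabel u p) = side3 (relabel u' p)].
Proof.
move=> uo uo' pl us us' E.
have vo := obtuse_relabel pl uo; have vo' := obtuse_relabel pl uo'.
have [s1 s2 s3] := sides_ge0 vo; have [s1' s2' s3'] := sides_ge0 vo'.
have := corners_uniq pl; rewrite /= !inE negb_or => /and3P[/andP[ab ac] bc _].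
rewrite ![vertex_index p == _]eq_sym in ab ac; rewrite eq_sym in bc.
have lt := corners_lt pl.
have C n : n \in corners p -> exists m : 'I_30, n = m /\ coords u 0 m = coords u' 0 m.
  by move=> /lt n30; exists (Ordinal n30); rewrite E.
apply: (surface_radial s1 s2 s3 s1' s2' s3'); try exact: standard_surface.
- have [|m [mE]] := C (vertex_index p); first by rewrite inE eqxx.
  rewrite (triangle_coord uo pl us) (triangle_coord uo' pl us') -mE eqxx.
  by rewrite (triangle_total uo pl us) (triangle_total uo' pl us').
- have [|m [mE]] := C (vertex_index (turn p)); first by rewrite !inE eqxx orbT.
  rewrite (triangle_coord uo pl us) (triangle_coord uo' pl us') -mE eqxx.
  by rewrite (negPf ab) (triangle_total uo pl us) (triangle_total uo' pl us').
- have [|m [mE]] := C (vertex_index (turn (turn p))); first by rewrite !inE eqxx !orbT.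
  rewrite (triangle_coord uo pl us) (triangle_coord uo' pl us') -mE eqxx.
  rewrite (negPf ac) (negPf bc).
  by rewrite (triangle_total uo pl us) (triangle_total uo' pl us').
Qed.
End Coordinates.

(** * Configurations with prescribed coordinates *)

Section Frames.
Variable R : realType.
Implicit Types u w : nat -> 'rV[R]_3.

Lemma det3Nr (a b c : 'rV[R]_3) : det3 a b (- c) = - det3 a b c.
Proof. by rewrite /det3 !mxE; ring. Qed.

Definition vec3 (x y z : R) : 'rV[R]_3 := \row_(j < 3) nth 0 [:: x; y; z] j.

Lemma vec3E x y z : (vec3 x y z 0 0 = x) * (vec3 x y z 0 1 = y) * (vec3 x y z 0 2%:R = z).
Proof. by rewrite !mxE. Qed.

Lemma dotv_vec3 x y z x' y' z' :
  dotv (vec3 x y z) (vec3 x' y' z') = x * x' + y * y' + z * z'.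
Proof. by rewrite dotvE !vec3E. Qed.

Definition cross (u v : 'rV[R]_3) := vec3
  (u 0 1 * v 0 2%:R - u 0 2%:R * v 0 1)
  (u 0 2%:R * v 0 0 - u 0 0 * v 0 2%:R)
  (u 0 0 * v 0 1 - u 0 1 * v 0 0).

Lemma dotv_cross (a b c : 'rV[R]_3) : dotv c (cross a b) = det3 a b c.
Proof. by rewrite dotvE !vec3E /det3; ring. Qed.

Definition frame w : 'M[R]_3 :=
  \matrix_(i < 3) nth 0 [:: w 0%N; w 2%N; cross (w 0%N) (w 2%N)] i.

Lemma mulmx_frame (v : 'rV[R]_3) w : v *m (frame w)^T =
  vec3 (dotv v (w 0%N)) (dotv v (w 2%N)) (det3 (w 0%N) (w 2%N) v).
Proof.
apply/rowP => i; rewrite -dotv_cross [RHS]mxE.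
have -> : (v *m (frame w)^T) 0 i = dotv v (row i (frame w)).
  by rewrite /dotv !mxE; apply: eq_bigr => j _; rewrite !mxE.
by rewrite rowK; case: i => -[|[|[|//]]].
Qed.

Lemma det_rows3 (a b c : 'rV[R]_3) :
  \det (\matrix_(i < 3) nth 0 [:: a; b; c] i) = det3 a b c.
Proof.
rewrite (expand_det_row _ 0) !big_ord_recl big_ord0 /cofactor.
rewrite !(expand_det_row _ 0) !big_ord_recl !big_ord0 /cofactor !det_mx11 !mxE /=.
rewrite /det3 /= /bump /= ?addn0 ?add0n ?expr0 ?expr1 ?expr2.
have e0 (v : 'rV[R]_3) i : val i = 0%N -> v 0 i = v 0 0.
  by move=> i0; congr (v 0 _); apply/val_inj.
have e1 (v : 'rV[R]_3) i : val i = 1%N -> v 0 i = v 0 1.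
  by move=> i0; congr (v 0 _); apply/val_inj.
have e2 (v : 'rV[R]_3) i : val i = 2%N -> v 0 i = v 0 2%:R.
  by move=> i0; congr (v 0 _); apply/val_inj.
repeat match goal with |- context [fun_of_matrix ?v ?z (lift ?x ?y)] =>
  first [rewrite (e0 v (lift x y) erefl) | rewrite (e1 v (lift x y) erefl)
        | rewrite (e2 v (lift x y) erefl)] end.
change (@ord0 2) with (0 : 'I_3); ring.
Qed.

Lemma frame_orthogonal w : obtuse w -> standard w ->
  frame w *m (frame w)^T = 1%:M /\ \det (frame w) = 1.
Proof.
move=> [w1 _] [_ [z2 _ _] _].
have c0 : det3 (w 0%N) (w 2%N) (w 0%N) = 0 by rewrite /det3; ring.
have c2 : det3 (w 0%N) (w 2%N) (w 2%N) = 0 by rewrite /det3; ring.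
have c1 : det3 (w 0%N) (w 2%N) (cross (w 0%N) (w 2%N)) = 1.
  transitivity (dotv (w 0%N) (w 0%N) * dotv (w 2%N) (w 2%N) - dotv (w 0%N) (w 2%N) ^+ 2).
    by rewrite !dotvE /det3 !vec3E; ring.
  by rewrite !w1 // z2; ring.
split; last by rewrite det_rows3.
apply/row_matrixP => i; rewrite row_mul mulmx_frame rowK row1.
have y2 := z2; rewrite dotvC in y2.
have d0 : dotv (cross (w 0%N) (w 2%N)) (w 0%N) = 0 by rewrite dotvC dotv_cross.
have d2 : dotv (cross (w 0%N) (w 2%N)) (w 2%N) = 0 by rewrite dotvC dotv_cross.
case: i => -[|[|[|//]]] i3 /=; rewrite ?w1 // ?c0 ?c1 ?c2 ?d0 ?d2 ?z2 ?y2;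
  by apply/rowP => j; rewrite !mxE; case: j => -[|[|[|//]]].
Qed.

(** The standard configuration with two prescribed sides; the third one is
    determined by the equation of [standard_surface]. *)
Definition model (a c : R) (n : nat) : 'rV[R]_3 :=
  nth 0 [:: vec3 1 0 0; vec3 (-1) 0 0; vec3 0 1 0;
            vec3 0 (- a) (Num.sqrt (1 - a ^+ 2));
            vec3 0 (- c) (- Num.sqrt (1 - c ^+ 2))] n.

(** In its own frame a standard configuration is a function of its sides: the dot
    products give the first two coordinates, and the third is a square root whose
    sign is fixed by the orientation. *)
Lemma frame_model w n : obtuse w -> standard w -> (n < 5)%N ->
  w n *m (frame w)^T = model (side1 w) (side3 w) n.
Proof.
move=> wo ws; have [D1 _ D3] := standard_det_sqr wo ws.
have [w1 _] := wo; have [wE [z2 z3 z4] [d1 d2 d3]] := ws.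
have c0 : det3 (w 0%N) (w 2%N) (w 0%N) = 0 by rewrite /det3; ring.
have c2 : det3 (w 0%N) (w 2%N) (w 2%N) = 0 by rewrite /det3; ring.
rewrite mulmx_frame; case: n => [|[|[|[|[|//]]]]] _; rewrite /model /=.
- by rewrite w1 // z2 c0.
- by rewrite wE !dotvNl w1 // z2 oppr0 det3Nr c0 oppr0.
- by rewrite dotvC z2 w1 // c2.
- by rewrite dotvC z3 dotvC /side1 opprK -D1 sqrtr_sqr ger0_norm.
- by rewrite dotvC z4 /side3 opprK -D3 sqrtr_sqr ger0_norm // det3_swap.
Qed.

(** Two standard configurations with equal sides have equal coordinates in their frames. *)
Lemma same_sides_rotation w w' : obtuse w -> obtuse w' -> standard w -> standard w' ->
  side1 w = side1 w' -> side3 w = side3 w' ->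
  exists2 A, SO3 A & forall n, (n < 5)%N -> w' n = w n *m A^T.
Proof.
move=> wo wo' ws ws' e1 e3.
have [F dF] := frame_orthogonal wo ws; have [F' dF'] := frame_orthogonal wo' ws'.
exists ((frame w')^T *m frame w).
  split; last by rewrite det_mulmx det_tr dF dF' mulr1.
  by rewrite trmx_mul trmxK -mulmxA (mulmxA (frame w)) F mul1mx mulmx1C.
move=> n n5; rewrite trmx_mul trmxK mulmxA (frame_model wo ws n5).
by rewrite e1 e3 -(frame_model wo' ws' n5) -mulmxA (mulmx1C F') mulmx1.
Qed.

Lemma model_standard (a b c : R) : 0 <= a -> 0 <= b -> 0 <= c ->
  a ^+ 2 + b ^+ 2 + c ^+ 2 + 2 * a * b * c = 1 ->
  let w := model a c in
  [/\ obtuse w, standard w & [/\ side1 w = a, side2 w = b & side3 w = c]].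
Proof.
move=> a0 b0 c0 E /=.
have abc : 0 <= a * b * c by rewrite !mulr_ge0.
have [sa sc] : 0 <= 1 - a ^+ 2 /\ 0 <= 1 - c ^+ 2 by split; nra.
set s := Num.sqrt (1 - a ^+ 2); set t := Num.sqrt (1 - c ^+ 2).
have s0 : 0 <= s by rewrite sqrtr_ge0.
have t0 : 0 <= t by rewrite sqrtr_ge0.
have sE : s * s = 1 - a ^+ 2 by rewrite -expr2 sqr_sqrtr.
have tE : t * t = 1 - c ^+ 2 by rewrite -expr2 sqr_sqrtr.
have stE : s * t = a * c + b.
  apply/eqP; rewrite -(@eqrXn2 _ 2) ?addr_ge0 ?mulr_ge0 //; apply/eqP.
  transitivity ((s * s) * (t * t)); first by ring.
  by rewrite sE tE; nra.
have m n : model a c n = nth 0 [:: vec3 1 0 0; vec3 (-1) 0 0; vec3 0 1 0;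
  vec3 0 (- a) s; vec3 0 (- c) (- t)] n by [].
have ac0 : 0 <= a * c by rewrite mulr_ge0.
clearbody s t.
split; first split.
- by case=> [|[|[|[|[|//]]]]] _; rewrite m dotv_vec3; nra.
- case=> [|[|[|[|[|//]]]]]; case=> [|[|[|[|[|//]]]]] // _ _ _;
    by rewrite !m dotv_vec3; nra.
- split; rewrite !m /= ?dotv_vec3.
  + by apply/rowP => i; rewrite !mxE; case: i => -[|[|[|//]]] ? /=; rewrite ?oppr0.
  + by split; ring.
  + rewrite /det3 !vec3E; split; [nra| |nra].
    have : 0 <= a * t by rewrite mulr_ge0.
    have : 0 <= s * c by rewrite mulr_ge0.
    nra.
- rewrite /side1 /side2 /side3 !m !dotv_vec3; split; nra.
Qed.

(** The polynomial in s is negative at 0 and, because the three squares add up to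
    at least 1/3, positive at 2. *)
Lemma surface_scale (x y z : R) : 0 <= x -> 0 <= y -> 0 <= z -> x + y + z = 1 ->
  exists2 s, 0 < s &
    (s * x) ^+ 2 + (s * y) ^+ 2 + (s * z) ^+ 2 + 2 * (s * x) * (s * y) * (s * z) = 1.
Proof.
move=> x0 y0 z0 E.
pose P : {poly R} := (x ^+ 2 + y ^+ 2 + z ^+ 2) *: 'X^2 + (2 * x * y * z) *: 'X^3 - 1.
have T : 0 <= x * y * z by rewrite !mulr_ge0.
have Q : 1 / 3%:R <= x ^+ 2 + y ^+ 2 + z ^+ 2.
  have -> : z = 1 - x - y by lra.
  have := sqr_ge0 (x - y); have := sqr_ge0 (x + 2 * y - 1).
  have := sqr_ge0 (2 * x + y - 1); nra.
have [|s /andP[s0 s2]] := @poly_ivt _ P 0 2 (ler0n _ _).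
  rewrite !hornerE /=.  apply/andP; split; nra.
move=> /rootP; rewrite !hornerE => sP.
have {}sP : (x ^+ 2 + y ^+ 2 + z ^+ 2) * s * s + 2 * x * y * z * s * s * s - 1 = 0 by [].
exists s.
  rewrite lt_neqAle s0 andbT; apply/eqP => s00.
  by move: sP; rewrite -s00 => sP; lra.
by lra.
Qed.

Lemma labeling_config (w : nat -> 'rV[R]_3) p : p \in labelings -> obtuse w -> standard w ->
  let u n := w (index n p) in
  [/\ obtuse u, standard (relabel u p) &
   [/\ side1 (relabel u p) = side1 w, side2 (relabel u p) = side2 w & side3 (relabel u p) = side3 w]].
Proof.
move=> pl [w1 w0] ws u.
have pp : perm_eq p id5 by rewrite -labeling_perm.
have up : uniq p by rewrite (perm_uniq pp) iota_uniq.
have sp := size_labeling pl.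
have inp n : (n < 5)%N -> n \in p by move=> n5; rewrite (perm_mem pp) mem_iota.
have lt n : (n < 5)%N -> (index n p < 5)%N by move=> n5; rewrite -sp index_mem inp.
have uE n : (n < 5)%N -> relabel u p n = w n.
  by move=> n5; rewrite /relabel /u index_uniq // sp.
split; last by rewrite /side1 /side2 /side3 !uE.
  split=> [n n5|m n m5 n5 mn]; first by rewrite w1 ?lt.
  rewrite w0 ?lt //; apply: contraNneq mn => E.
  by rewrite -(nth_index 0%N (inp _ m5)) E nth_index ?inp.
by rewrite /standard !uE.
Qed.

Lemma coords_surj (x : 'rV[R]_30) p : p \in labelings ->
  (forall i, 0 <= x 0 i) -> \sum_i x 0 i = 1 ->
  (forall i : 'I_30, x 0 i != 0 -> (i : nat) \in corners p) ->
  exists2 u, obtuse u & coords u = x.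
Proof.
move=> pl x0 x1 xs.
have lt := corners_lt pl; have U := corners_uniq pl.
have [a aE] : exists a : 'I_30, a = vertex_index p :> nat.
  by have := lt (vertex_index p); rewrite !inE eqxx => /(_ isT) l; exists (Ordinal l).
have [b bE] : exists a : 'I_30, a = vertex_index (turn p) :> nat.
  by have := lt (vertex_index (turn p)); rewrite !inE eqxx orbT => /(_ isT) l; exists (Ordinal l).
have [c cE] : exists a : 'I_30, a = vertex_index (turn (turn p)) :> nat.
  by have := lt (vertex_index (turn (turn p))); rewrite !inE eqxx !orbT => /(_ isT) l; exists (Ordinal l).
have xE i : x 0 i = if i == vertex_index p :> nat then x 0 a else if i == vertex_index (turn p) :> nat then x 0 b
                    else if i == vertex_index (turn (turn p)) :> nat then x 0 c else 0.
  rewrite -aE -bE -cE !val_eqE; have [->//|ia] := eqVneq i a.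
  have [->//|ib] := eqVneq i b; have [->//|ic] := eqVneq i c.
  apply/eqP; apply: contraNT ia => /xs.
  by rewrite !inE -aE -bE -cE !val_eqE (negPf ib) (negPf ic) !orbF.
have s1 : x 0 a + x 0 b + x 0 c = 1.
  rewrite -(sum_corners _ _ _ U) ?lt ?inE ?eqxx ?orbT // -[RHS]x1.
  by apply: eq_bigr => i _; rewrite -xE.
have [s s0 sE] := surface_scale (x0 a) (x0 b) (x0 c) s1.
have [||| wo ws [e1 e2 e3]] := model_standard _ _ _ sE; rewrite ?mulr_ge0 // ?ltW //.
have /= [uo us [f1 f2 f3]] := labeling_config pl wo ws.
exists (fun n => model (s * x 0 a) (s * x 0 c) (index n p)) => //.
apply/rowP => i; rewrite (triangle_coord uo pl us) (triangle_total uo pl us).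
rewrite f1 f2 f3 e1 e2 e3 -!mulrDr s1 mulr1 [RHS]xE.
have sn0 : s != 0 by rewrite gt_eqF.
by do 3?case: ifP => _; rewrite ?mul0r // mulrC mulKf.
Qed.
End Frames.

(** * Continuity and compactness *)

Section RealFunctions.
Variables (R : realType) (T : topologicalType).
Implicit Types f g : T -> R.

Lemma cont_cst (c : R) : continuous (fun _ : T => c).
Proof. by move=> x; exact: cvg_cst. Qed.

Lemma contD f g : continuous f -> continuous g -> continuous (fun x => f x + g x).
Proof. by move=> cf cg x; apply: cvgD; [exact: cf|exact: cg]. Qed.

Lemma contN f : continuous f -> continuous (fun x => - f x).
Proof. by move=> cf x; apply: cvgN; exact: cf. Qed.

Lemma contM f g : continuous f -> continuous g -> continuous (fun x => f x * g x).
Proof. by move=> cf cg x; apply: cvgM; [exact: cf|exact: cg]. Qed.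

Lemma contV f : (forall x, f x != 0) -> continuous f -> continuous (fun x => (f x)^-1).
Proof. by move=> f0 cf x; apply: cvgV => //; exact: cf. Qed.

Lemma cont_min f g : continuous f -> continuous g -> continuous (fun x => Num.min (f x) (g x)).
Proof. by move=> cf cg x; apply: continuous_min; [exact: cf|exact: cg]. Qed.

Lemma cont_max f g : continuous f -> continuous g -> continuous (fun x => Num.max (f x) (g x)).
Proof. by move=> cf cg x; apply: continuous_max; [exact: cf|exact: cg]. Qed.

Lemma cont_sum (I : Type) (r : seq I) (P : pred I) (F : I -> T -> R) :
  (forall i, continuous (F i)) -> continuous (fun x => \sum_(i <- r | P i) F i x).
Proof.
move=> cF; elim: r => [|i r IH].
  by rewrite (_ : (fun x => _) = fun=> 0); [exact: cont_cst|apply/funext => x; rewrite big_nil].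
case Pi : (P i); last first.
  by rewrite (_ : (fun x => _) = fun x => \sum_(i <- r | P i) F i x) //; apply/funext => x;
    rewrite big_cons Pi.
rewrite (_ : (fun x => _) = fun x => F i x + \sum_(i <- r | P i) F i x).
  exact: contD.
by apply/funext => x; rewrite big_cons Pi.
Qed.
End RealFunctions.

Lemma cont_mx (R : realType) (T : topologicalType) m n (f : T -> 'M[R]_(m, n)) :
  (forall i j, continuous (fun x => f x i j)) -> continuous f.
Proof.
move=> cf x A [P Pf PA]; apply: (@filterS _ _ _ [set y | forall i j, P i j (f y i j)]).
  by move=> y Py; exact: PA.
apply: (@filter_forall _ _ (fun i y => forall j, P i j (f y i j))) => i.
apply: (@filter_forall _ _ (fun j y => P i j (f y i j))) => j.
exact: cf.
Qed.

Section Subtypes.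
Variables (X : topologicalType) (A : set X).

Lemma set_val_continuous : continuous (set_val : A -> X).
Proof. exact: initial_continuous. Qed.

Lemma set_type_continuous (T : topologicalType) (f : T -> A) :
  continuous (fun x => set_val (f x)) -> continuous f.
Proof. exact: continuous_comp_initial. Qed.

Lemma compact_set_type : compact A -> compact [set: A].
Proof.
move=> cA F PF FT; have [] := cA (fmap set_val F).
- by apply: (@filterS _ F _ [set: A]) => // x _; exact: set_valP.
- move=> p [Ap clp]; exists (SigSub (mem_set Ap)); split=> // B C FB.
  move=> [_ [[W oW <-] /= Wp]] WC.
  have [y [[x Bx <-] Wy]] : (set_val @` B) `&` W !=set0.
    apply: clp; last by apply: open_nbhs_nbhs; split.
    by apply: (@filterS _ F _ B) => // x Bx; exists x.
  by exists x; split=> //; exact: WC.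
Qed.

Lemma hausdorff_set_type : hausdorff_space X -> hausdorff_space A.
Proof.
move=> hX p q pq; apply/val_inj/hX => B C pB qC.
have [z [Bz Cz]] := pq _ _ (set_val_continuous pB) (set_val_continuous qC).
by exists (set_val z).
Qed.
End Subtypes.

(** Closed sets of X are compact, so their images are closed and the inverse is continuous. *)
Lemma compact_bij_homeomorphic (X Y : topologicalType) (f : X -> Y) :
  compact [set: X] -> hausdorff_space Y -> continuous f -> injective f ->
  (forall y, exists x, f x = y) -> homeomorphic X Y.
Proof.
move=> cX hY cf fi fs; have [g gK] := choice fs.
have fK : cancel f g by move=> x; apply: fi; rewrite gK.
exists f, g; split=> //; apply/continuous_closedP => C cC.
have -> : g @^-1` C = f @` C.
  apply/seteqP; split=> y /=; first by exists (g y).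
  by case=> x Cx <-; rewrite /= fK.
apply: compact_closed => //; apply: continuous_compact.
  exact: continuous_subspaceT.
exact: subclosed_compact cC cX _.
Qed.

(** Matrices are reshaped into rows, for which compactness of boxes is known. *)
Lemma compact_mx (R : realType) m n (A : set 'M[R]_(m, n)) :
  closed A -> (forall M i j, A M -> -1 <= M i j <= 1) -> compact A.
Proof.
move=> cA bA.
have cv : continuous (vec_mx : 'rV[R]_(m * n) -> 'M[R]_(m, n)).
  apply: cont_mx => i j.
  rewrite (_ : (fun _ => _) = fun v : 'rV[R]_(m * n) => v 0 (mxvec_index i j)).
    exact: coord_continuous.
  by apply/funext => v; rewrite mxE.
have -> : A = vec_mx @` (vec_mx @^-1` A).
  by apply/seteqP; split=> [M AM|M [v Av <-] //]; exists (mxvec M); rewrite /= ?mxvecK.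
apply: continuous_compact; first exact: continuous_subspaceT.
apply: subclosed_compact (@rV_compact R _ (fun=> `[-1, 1]%classic) _) _.
- by move/continuous_closedP: cv; apply.
- by move=> _; exact: segment_compact.
- move=> v /= Av i; rewrite /= in_itv /=.
  by case/mxvec_indexP: i => i j; have := bA _ i j Av; rewrite mxE.
Qed.

(** * Square roots of planar maps *)

Section SquareRoots.
Variables (R : realType) (X : topologicalType).

(** With a + i b and p + i q for the pairs: (p + i q)^2 is a positive multiple of
    a + i b.  Dropping the absolute value spares every normalization. *)
Definition has_sqrt (a b : X -> R) : Prop := exists p q : X -> R,
  [/\ continuous p, continuous q & forall x, exists2 c, 0 < c &
     p x ^+ 2 - q x ^+ 2 = c * a x /\ 2 * p x * q x = c * b x].

Lemma has_sqrt_cst (a b : R) : 0 < a ^+ 2 + b ^+ 2 -> has_sqrt (fun=> a) (fun=> b).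
Proof.
move=> ab0; pose r := Num.sqrt (a ^+ 2 + b ^+ 2).
have r0 : 0 < r by rewrite sqrtr_gt0.
have rE : r ^+ 2 = a ^+ 2 + b ^+ 2 by rewrite sqr_sqrtr // ltW.
have [ra|ra] := ltP 0 (r + a).
  exists (fun=> r + a), (fun=> b); split; [exact: cont_cst|exact: cont_cst|move=> _].
  exists (2 * (r + a)); first by rewrite mulr_gt0.
  by split; nra.
exists (fun=> 0), (fun=> 1); split; [exact: cont_cst|exact: cont_cst|move=> _].
have b0 : b = 0 by nra.
have a0 : a < 0 by nra.
exists (- a^-1); first by rewrite oppr_gt0 invr_lt0.
by rewrite b0 mulNr mulVf ?lt_eqF //; split; ring.
Qed.

(** If z' is a value whose inner product with z is positive and w is a square root
    of z, then (|z'| + z' conj(w) / w) w is a square root of z': it is a principal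
    root of z' times the real number 2 Re (conj(sqrt z') w), which does not vanish. *)
Lemma has_sqrt_near (a b a' b' : X -> R) : continuous a' -> continuous b' ->
  (forall x, 0 < a x * a' x + b x * b' x) -> has_sqrt a b -> has_sqrt a' b'.
Proof.
move=> ca' cb' ab [p [q [cp cq pq]]].
pose r x := Num.sqrt (a' x * a' x + b' x * b' x).
have cr : continuous r.
  have cs : continuous (fun x => a' x * a' x + b' x * b' x) by apply: contD; exact: contM.
  by move=> x; apply: continuous_comp; [exact: cs|exact: sqrt_continuous].
exists (fun x => (r x * p x + a' x * p x) + b' x * q x),
  (fun x => (r x * q x + b' x * p x) - a' x * q x); split.
- by do ?apply: contD; apply: contM.
- by apply: contD; [apply: contD|apply: contN]; apply: contM.
move=> x; have [c c0 [E1 E2]] := pq x; have := ab x.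
have r0 : 0 <= r x by rewrite sqrtr_ge0.
have rE : r x ^+ 2 = a' x ^+ 2 + b' x ^+ 2.
  by rewrite sqr_sqrtr ?expr2 // addr_ge0 // -expr2 sqr_ge0.
move: (r x) (p x) (q x) (a x) (b x) (a' x) (b' x) E1 E2 r0 rE => s u v A B A' B' E1 E2 s0 sE pos.
exists (2 * (s * (u ^+ 2 + v ^+ 2) + c * (A * A' + B * B'))).
  rewrite mulr_gt0 // ltr_wpDl ?mulr_gt0 // mulr_ge0 //.
  by rewrite addr_ge0 ?sqr_ge0.
have E : c * (A * A' + B * B') = A' * (u ^+ 2 - v ^+ 2) + B' * (2 * u * v).
  by rewrite E1 E2; ring.
rewrite E; split.
  transitivity ((s ^+ 2) * (u ^+ 2 - v ^+ 2) + (A' ^+ 2 - B' ^+ 2) * (u ^+ 2 - v ^+ 2)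
     + 2 * s * A' * (u ^+ 2 + v ^+ 2) + 4 * A' * B' * u * v); first by ring.
  by rewrite sE; ring.
transitivity (2 * (s ^+ 2 - A' ^+ 2) * u * v + 2 * s * B' * (u ^+ 2 + v ^+ 2)
  + 2 * A' * B' * (u ^+ 2 - v ^+ 2) + 2 * B' ^+ 2 * u * v); first by ring.
by rewrite sE; ring.
Qed.

(** Along a contraction the map is deformed to a constant one, which has a square
    root.  By compactness the time interval can be cut into steps so short that the
    values at each point change by less than a right angle, and [has_sqrt_near]
    carries the square root back step by step. *)
Lemma contractible_has_sqrt (a b : X -> R) : compact [set: X] -> contractible R X ->
  continuous a -> continuous b -> (forall x, 0 < a x ^+ 2 + b x ^+ 2) -> has_sqrt a b.
Proof.
move=> cX [c [H [cH H0 H1]]] ca cb ab.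
pose D : set (X * R) := [set: X] `*` `[0, 1]%classic.
pose A z := a (H z); pose B z := b (H z).
have inD x t : 0 <= t <= 1 -> D (x, t) by move=> t01; split=> //=; rewrite in_itv.
have nearH (f : X -> R) : continuous f -> forall z, D z -> forall U, nbhs (f (H z)) U ->
    nbhs z [set z' | D z' -> U (f (H z'))].
  move=> cf z Dz U /cf/= fU; have /subspace_continuousP/(_ z Dz) := cH.
  by move=> /(_ _ fU).
have slice (f : X -> R) t : continuous f -> 0 <= t <= 1 -> continuous (fun x => f (H (x, t))).
  move=> cf t01 x U /(nearH _ cf _ (inD x t t01)) [[Q1 Q2] /= [n1 n2] QU].
  apply: (@filterS _ _ _ Q1) => // y Q1y; apply: (QU (y, t)); last exact: inD.
  by split=> //=; exact: nbhs_singleton n2.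
(* On the compact cylinder two values at nearby times are never opposite. *)
have [d d0 close] : exists2 d : R, 0 < d & forall x t t', 0 <= t <= 1 -> 0 <= t' <= 1 ->
    `|t - t'| < d -> 0 < A (x, t) * A (x, t') + B (x, t) * B (x, t').
  have : compact D by apply: compact_setX => //; exact: segment_compact.
  move/compact_near_coveringP/near_covering_withinP.
  pose P (d : R) (z : X * R) := forall t', 0 <= t' <= 1 -> `|z.2 - t'| < d ->
    0 < A z * A (z.1, t') + B z * B (z.1, t').
  move=> /(_ R (0^'+) P _); case.
    move=> z0 Dz0.
    (* The two half-planes bound a quadrant centered at the value at z0; any two of
     its values have positive inner product. *)
    have cone (s : R) : s = 1 \/ s = -1 -> nbhs z0 [set z | D z ->
        0 < (a (H z0) * A z + b (H z0) * B z) + s * (a (H z0) * B z - b (H z0) * A z)].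
      move=> _.
      pose f x := (a (H z0) * a x + b (H z0) * b x) + s * (a (H z0) * b x - b (H z0) * a x).
      have cf : continuous f.
        apply: contD; first by apply: contD; apply: contM => //; exact: cont_cst.
        apply: contM; first exact: cont_cst.
        by apply: contD; [|apply: contN]; apply: contM => //; exact: cont_cst.
      apply: (nearH f cf z0 Dz0 [set y | 0 < y]); apply: open_nbhs_nbhs; split.
        exact: open_gt.
      by rewrite /f /=; have := ab (H z0); nra.
    have nU := filterI (cone 1 (or_introl erefl)) (cone (-1) (or_intror erefl)).
    case: nU => -[Q1 Q2] /= [n1 /nbhs_ballP[e /= e0 eQ]] QU.
    exists ([set z | Q1 z.1 /\ ball z0.2 (e / 2) z.2], [set d | d < e / 2]).
      split=> /=.
        exists (Q1, ball z0.2 (e / 2)) => //=; split=> //=.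
        by apply: nbhsx_ballx; rewrite divr_gt0.
      by apply: nbhs_right_lt; rewrite divr_gt0.
    case=> -[x t] d /= [[Q1x te] de] [_ /=]; rewrite in_itv /= => t01 t' t'01 /= tt'.
    have tQ : Q2 t by apply: eQ; apply: le_ball te; lra.
    have t'Q : Q2 t'.
      apply: eQ; rewrite /ball /=; rewrite /ball /= in te.
      have -> : z0.2 - t' = (z0.2 - t) + (t - t') by ring.
      by apply: le_lt_trans (ler_normD _ _) _; lra.
    have [/(_ (inD _ _ t01)) + /(_ (inD _ _ t01)) +] := QU (x, t) (conj Q1x tQ).
    have [/(_ (inD _ _ t'01)) + /(_ (inD _ _ t'01)) +] := QU (x, t') (conj Q1x t'Q).
    have := ab (H z0).
    move: (a (H z0)) (b (H z0)) (A (x, t)) (B (x, t)) (A (x, t')) (B (x, t')).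
    move=> a0 b0 A1 B1 A2 B2 r0 P1 P2 P3 P4.
    rewrite -(pmulr_rgt0 _ r0).
    set s1 := a0 * A1 + b0 * B1 in P3 P4; set w1 := a0 * B1 - b0 * A1 in P3 P4.
    set s2 := a0 * A2 + b0 * B2 in P1 P2; set w2 := a0 * B2 - b0 * A2 in P1 P2.
    have -> : (a0 ^+ 2 + b0 ^+ 2) * (A1 * A2 + B1 * B2) = s1 * s2 + w1 * w2.
      by rewrite /s1 /s2 /w1 /w2; ring.
    have : 0 < (s1 + w1) * (s2 + w2) by apply: mulr_gt0; lra.
    have : 0 < (s1 - w1) * (s2 - w2) by apply: mulr_gt0; lra.
    by lra.
  move=> /= e e0 eP; exists (e / 2); first by rewrite divr_gt0.
  move=> x t t' t01 t'01 tt'; apply: (eP (e / 2)) => //=; rewrite ?divr_gt0 //.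
    by rewrite sub0r normrN gtr0_norm ?divr_gt0 //; lra.
have step t t' : 0 <= t <= 1 -> 0 <= t' <= 1 -> `|t - t'| < d ->
    has_sqrt (fun x => A (x, t)) (fun x => B (x, t)) ->
    has_sqrt (fun x => A (x, t')) (fun x => B (x, t')).
  by move=> t01 t'01 tt'; apply: has_sqrt_near; [exact: slice|exact: slice|move=> x; exact: close].
pose N := Num.bound d^-1.
have dN : d^-1 < N%:R by apply: archi_boundP; rewrite invr_ge0 ltW.
have N0 : 0 < N%:R :> R by apply: lt_trans dN; rewrite invr_gt0.
have Nd : N%:R^-1 < d by rewrite -[d]invrK ltf_pV2 // posrE // invr_gt0.
have down k : (k <= N)%N ->
    has_sqrt (fun x => A (x, 1 - k%:R / N%:R)) (fun x => B (x, 1 - k%:R / N%:R)).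
  elim: k => [_|k IH kN].
    rewrite mul0r subr0 (_ : (fun x => A _) = fun=> a c); last by apply/funext => x; rewrite /A H1.
    by rewrite (_ : (fun x => B _) = fun=> b c); [exact: has_sqrt_cst|apply/funext => x; rewrite /B H1].
  have unit j : (j <= N)%N -> 0 <= (1 - j%:R / N%:R : R) <= 1.
    move=> jN; have j0 : 0 <= j%:R / N%:R :> R by rewrite divr_ge0 // ltW.
    have j1 : j%:R / N%:R <= 1 :> R by rewrite ler_pdivrMr // mul1r ler_nat.
    by apply/andP; split; lra.
  apply: step (IH (ltnW kN)); [exact: unit (ltnW kN)|exact: unit|].
  have -> : 1 - k%:R / N%:R - (1 - k.+1%:R / N%:R) = N%:R^-1 :> R.
    by rewrite -natr1; field; rewrite gt_eqF.
  by rewrite gtr0_norm // invr_gt0.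
have := down N (leqnn N); rewrite divff ?gt_eqF // subrr.
rewrite (_ : (fun x => A _) = a); last by apply/funext => x; rewrite /A H0.
by rewrite (_ : (fun x => B _) = b) //; apply/funext => x; rewrite /B H0.
Qed.
End SquareRoots.

(** * The simplicial complex *)

Definition face (t : seq nat) : {set 'I_30} := [set i : 'I_30 | (i : nat) \in t]%SET.

Definition complexK : {set {set 'I_30}} :=
  [set s | (s != finset.set0) && has (fun t => s \subset face t) triangles]%SET.

Lemma mem_complexK s : (s \in complexK) =
  (s != finset.set0) && has (fun t => s \subset face t) triangles.
Proof. by rewrite finset.in_set. Qed.

Lemma mem_face i t : (i \in face t) = ((i : nat) \in t).
Proof. by rewrite finset.in_set. Qed.

Lemma card_face t : uniq t -> all (ltn^~ 30%N) t -> #|face t| = size t.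
Proof.
move=> ut /allP lt; rewrite cardE -(size_map val); apply: perm_size.
apply: uniq_perm => //; first by rewrite (map_inj_uniq val_inj) enum_uniq.
move=> n; apply/mapP/idP => [[i + ->]|nt]; first by rewrite mem_enum mem_face.
by exists (Ordinal (lt n nt)); rewrite // mem_enum mem_face.
Qed.

Lemma card_triangle t : t \in triangles -> #|face t| = 3%N.
Proof.
move/(allP triangles_size)/and3P=> [ut lt /eqP st].
by rewrite card_face.
Qed.

(** Two triangles have at most a corner in common, so each edge lies in one triangle only. *)
Lemma card_triangles_meet t t' : t \in triangles -> t' \in triangles -> t != t' ->
  (#|face t :&: face t'| <= 1)%N.
Proof.
move=> tT t'T tt'.
have := allP (allP triangles_meet t tT) t' t'T; rewrite tt' /=; apply: leq_trans.
have /and3P[ut lt _] := allP triangles_size t tT.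
rewrite -card_face ?filter_uniq //; last first.
  by apply/allP => i; rewrite mem_filter => /andP[_]; exact: (allP lt).
apply: subset_leq_card; apply/fintype.subsetP => i.
by rewrite finset.in_setI !mem_face mem_filter andbC.
Qed.

Lemma set1_complexK (i : 'I_30) : [set i]%SET \in complexK.
Proof.
rewrite mem_complexK; apply/andP; split.
  by apply/finset.set0Pn; exists i; rewrite finset.in_set1.
have iI : (i : nat) \in iota 0 30 by rewrite mem_iota; exact: ltn_ord.
have /hasP[t tT it] := allP triangles_cover i iI.
by apply/hasP; exists t => //; rewrite finset.sub1set mem_face.
Qed.

Lemma simplicial_complexK : simplicial_complex complexK.
Proof.
split.
- by rewrite mem_complexK eqxx.
- exact: set1_complexK.
- move=> s t; rewrite !mem_complexK => /andP[_ /hasP[T TT sT]] ts -> /=.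
  by apply/hasP; exists T => //; exact: fintype.subset_trans sT.
Qed.

Lemma card_complexK s : s \in complexK -> (0 < #|s| <= 3)%N.
Proof.
rewrite mem_complexK card_gt0 => /andP[-> /hasP[t tT st]] /=.
by have := subset_leq_card st; rewrite card_triangle.
Qed.

Lemma complex_dimK : complex_dim complexK = 2%N.
Proof.
apply/eqP; rewrite eqn_leq; apply/andP; split.
  by apply/bigmax_leqP => s /card_complexK; case: #|s| => [|[|[|[]]]].
pose t := head [::] triangles; have tT : t \in triangles by vm_compute.
have tK : face t \in complexK.
  rewrite mem_complexK -card_gt0 card_triangle //=.
  by apply/hasP; exists t.
by have := @leq_bigmax_cond _ (mem complexK) (fun s => #|s|.-1) _ tK; rewrite card_triangle.
Qed.

(** Three edges and one triangle contribute -3 + 1. *)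
Lemma sum_triangle_faces (A : {set 'I_30}) : #|A| = 3%N ->
  \sum_(s : {set 'I_30} | (s \subset A) && (1 < #|s|)%N) (-1) ^+ #|s|.-1 = -2 :> int.
Proof.
move=> A3; have size_le (s : {set 'I_30}) : s \subset A -> (#|s| <= 3)%N by move/subset_leq_card; rewrite A3.
have count k : (\sum_(s : {set 'I_30} | (s \subset A) && (#|s| == k)) 1 = 'C(3, k))%N.
  by rewrite sum1_card -[in RHS]A3 -cards_draws cardsE.
rewrite (bigID (fun s : {set 'I_30} => #|s| == 2%N)) /=.
rewrite (eq_big (fun s : {set 'I_30} => (s \subset A) && (#|s| == 2%N)) (fun=> -1)); first last.
- by move=> s /andP[_ /eqP->].
- by move=> s; case: (_ \subset _) => //=; case: eqP => [->|] //=; rewrite ?andbF.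
rewrite [X in _ + X](eq_big (fun s : {set 'I_30} => (s \subset A) && (#|s| == 3%N)) (fun=> 1)); first last.
- move=> s /andP[/andP[sA s1] s2]; have := size_le s sA.
  by move: s1 s2; case: #|s| => [|[|[|[|]]]].
- move=> s; case sA: (s \subset A) => //=; have := size_le s sA.
  by case: #|s| => [|[|[|[|]]]].
rewrite !sumr_const -!sum1_card.
have c2 := count 2%N; have c3 := count 3%N.
rewrite (_ : 'C(3, 2) = 3%N) // in c2; rewrite (_ : 'C(3, 3) = 1%N) // in c3.
have -> : (\sum_(i in [pred s : {set 'I_30} | s \subset A & #|s| == 2]) 1 = 3)%N by rewrite -[RHS]c2.
by have -> : (\sum_(i in [pred s : {set 'I_30} | s \subset A & #|s| == 3]) 1 = 1)%N by rewrite -[RHS]c3.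
Qed.

(** An edge or triangle of the complex lies in exactly one of the 20 triangles. *)
Lemma sum_triangles_containing (s : {set 'I_30}) (x : int) : (1 < #|s|)%N ->
  \sum_(t <- triangles | s \subset face t) x = if s \in complexK then x else 0.
Proof.
move=> s1; rewrite mem_complexK -card_gt0 (ltnW s1) /=; case: ifP => [/hasP[t tT st]|/hasPn no].
  rewrite big_mkcond (bigD1_seq t) ?triangles_uniq //= st big1_seq ?addr0 // => t'.
  move=> /andP[t't t'T]; case: ifP => // st'; have := card_triangles_meet t'T tT t't.
  have : s \subset face t' :&: face t by rewrite finset.subsetI st' st.
  by move/subset_leq_card/(leq_trans s1) => H; rewrite leqNgt H.
by rewrite big1_seq // => t /andP[st /no]; rewrite st.
Qed.

(** The 30 vertices contribute 30, and the faces of positive dimension are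
    distributed over the 20 triangles, each of which contributes -2. *)
Lemma euler_charK : euler_char complexK = -10.
Proof.
rewrite /euler_char (bigID (fun s : {set 'I_30} => (1 < #|s|)%N)) /=.
have -> : \sum_(s in complexK | (1 < #|s|)%N) (-1) ^+ #|s|.-1 =
    \sum_(t <- triangles) (-2) :> int.
  transitivity (\sum_(s : {set 'I_30} | (1 < #|s|)%N)
      \sum_(t <- triangles | s \subset face t) (-1) ^+ #|s|.-1 : int).
    rewrite [RHS](eq_bigr (fun s : {set 'I_30} => if s \in complexK then (-1) ^+ #|s|.-1 else 0)).
      by rewrite -big_mkcondr; apply: eq_bigl => s; rewrite andbC.
    by move=> s s1; rewrite sum_triangles_containing.
  rewrite (exchange_big_dep xpredT) //= !big_seq; apply: eq_bigr => t tT.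
  apply: etrans (sum_triangle_faces (card_triangle tT)).
  by apply: eq_bigl => s; rewrite andbC.
have -> : \sum_(s in complexK | ~~ (1 < #|s|)%N) (-1) ^+ #|s|.-1 = 30%:R :> int.
  transitivity (\sum_(s in [set s : {set 'I_30} | #|s| == 1%N]%SET) 1 : int).
    apply: eq_big => s.
      rewrite finset.in_set -leqNgt; apply/andP/eqP => [[/card_complexK/andP[s0 _] s1]|s1].
        by apply/eqP; rewrite eqn_leq s1 s0.
      split; last by rewrite s1.
      by have /eqP/cards1P[i ->] := s1; exact: set1_complexK.
    rewrite -leqNgt => /andP[/card_complexK/andP[s0 _] s1].
    by have -> : #|s| = 1%N by apply/eqP; rewrite eqn_leq s1 s0.
  by rewrite sumr_const card_draws card_ord bin1.
have -> : triangles = take 20 triangles by vm_compute.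
by rewrite big_const_seq count_predT /=.
Qed.

(** * Points, segments and connectedness of the realization *)

Lemma realizationP (R : realType) (x : 'rV[R]_30) :
  realization_set R complexK x <->
  [/\ forall i, 0 <= x 0 i, \sum_i x 0 i = 1 &
    exists2 t, t \in triangles & forall i : 'I_30, x 0 i != 0 -> (i : nat) \in t].
Proof.
split=> [[x0 x1]|[x0 x1 [t tT st]]].
  rewrite mem_complexK => /andP[_ /hasP[t tT /fintype.subsetP st]]; split=> //.
  by exists t => // i xi; rewrite -mem_face; apply: st; rewrite finset.in_set.
split=> //; rewrite mem_complexK; apply/andP; split.
  apply/eqP => /setP E; have /eqP := x1; rewrite big1 1?eq_sym ?oner_eq0 // => i _.
  by have := E i; rewrite finset.in_set finset.in_set0 => /negbFE/eqP.
by apply/hasP; exists t => //; apply/fintype.subsetP => i; rewrite finset.in_set mem_face; exact: st.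
Qed.

Section Realization.
Variable R : realType.
Local Notation Y := (realization R complexK).

Definition supported (y : Y) (t : seq nat) :=
  forall i : 'I_30, set_val y 0 i != 0 -> (i : nat) \in t.

Lemma realization_supported (y : Y) : exists2 t, t \in triangles & supported y t.
Proof. by have /realizationP[_ _ [t]] := set_valP y; exists t. Qed.

Lemma coordY_ge0 (y : Y) i : 0 <= set_val y 0 i.
Proof. by have /realizationP[] := set_valP y. Qed.

Lemma coordY_sum (y : Y) : \sum_i set_val y 0 i = 1.
Proof. by have /realizationP[] := set_valP y. Qed.

Lemma cont_coordY i : continuous (fun y : Y => set_val y 0 i).
Proof.
move=> y; apply: (@continuous_comp _ _ _ (set_val : Y -> 'rV[R]_30) (fun v => v 0 i)).
  exact: set_val_continuous.
exact: coord_continuous.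
Qed.

Lemma coordY_out (y : Y) t (i : 'I_30) : supported y t -> (i : nat) \notin t -> set_val y 0 i = 0.
Proof. by move=> yt; apply: contraNeq => /yt. Qed.

(** The parameter of the segment is clamped to the unit interval, which makes the
    path a function on the whole line. *)
Lemma segment_path (y y' : Y) t : t \in triangles -> supported y t -> supported y' t ->
  exists g : R -> Y, [/\ continuous g, g 0 = y, g 1 = y' & forall s, supported (g s) t].
Proof.
move=> tT yt y't; pose c (s : R) := Num.min 1 (Num.max 0 s).
have c01 s : 0 <= c s <= 1.
  by rewrite /c ge_min lexx le_min ler01 le_max lexx.
pose v s : 'rV[R]_30 := (1 - c s) *: set_val y + c s *: set_val y'.
have vE s i : v s 0 i = (1 - c s) * set_val y 0 i + c s * set_val y' 0 i by rewrite !mxE.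
have vt s (i : 'I_30) : v s 0 i != 0 -> (i : nat) \in t.
  apply: contraNT => it; rewrite vE (coordY_out yt it) (coordY_out y't it).
  by rewrite !mulr0 addr0.
have vY s : realization_set R complexK (v s).
  have /andP[c0 c1] := c01 s; apply/realizationP; split; last by exists t => //; exact: vt.
    by move=> i; rewrite vE addr_ge0 // mulr_ge0 ?subr_ge0 // coordY_ge0.
  under eq_bigr do rewrite vE.
  by rewrite big_split /= -!mulr_sumr !coordY_sum !mulr1 subrK.
exists (fun s => SigSub (mem_set (vY s))); split.
- apply: set_type_continuous; apply: cont_mx => i j.
  rewrite (_ : (fun s => _) = fun s => (1 - c s) * set_val y 0 j + c s * set_val y' 0 j).
    have cc : continuous c.
      by apply: cont_min; [exact: cont_cst|apply: cont_max; [exact: cont_cst|by move=> x; exact: cvg_id]].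
    apply: contD; apply: contM => //; try exact: cont_cst.
    by apply: contD; [exact: cont_cst|exact: contN].
  by apply/funext => s; rewrite /= ord1 vE.
- apply/val_inj => /=; rewrite /v /c max_r // min_r //.
  by rewrite subr0 scale1r scale0r addr0.
- apply/val_inj => /=; rewrite /v /c max_r ?ler01 // min_l //.
  by rewrite subrr scale1r scale0r add0r.
- by move=> s i; exact: vt.
Qed.

Lemma vertex_pointP (i : 'I_30) : exists y : Y, set_val y = delta_mx 0 i.
Proof.
have iI : (i : nat) \in iota 0 30 by rewrite mem_iota; exact: ltn_ord.
have /hasP[t tT it] := allP triangles_cover i iI.
have yY : realization_set R complexK (delta_mx 0 i).
  apply/realizationP; split.
  - by move=> j; rewrite mxE; case: (_ && _).
  - rewrite (bigD1 i) //= big1 ?addr0 => [|j ji]; first by rewrite mxE !eqxx.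
    by rewrite mxE (negPf ji) andbF.
  - by exists t => // j; rewrite mxE eqxx /=; have [->|_] := eqVneq j i; rewrite ?eqxx.
by exists (SigSub (mem_set yY)).
Qed.

Definition vertex_point (n : nat) : Y := projT1 (cid (vertex_pointP (inord n))).

Lemma vertex_pointE n (i : 'I_30) : (n < 30)%N ->
  set_val (vertex_point n) 0 i = ((i : nat) == n)%:R.
Proof.
move=> n30; rewrite /vertex_point; case: cid => y /= ->.
by rewrite mxE eqxx /= -val_eqE /= inordK.
Qed.

Lemma vertex_point_supported n t : t \in triangles -> n \in t -> supported (vertex_point n) t.
Proof.
move=> tT nt i; have /and3P[_ /allP lt _] := allP triangles_size t tT.
have n30 : (n < 30)%N by exact: lt.
by rewrite vertex_pointE //; have [->|_] := eqVneq (i : nat) n; rewrite ?eqxx.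
Qed.

(** Every point is joined to a vertex inside a triangle, and the search of
    [grow_all] reaches all the vertices from vertex 0. *)
Lemma connected_realization : connected [set: Y].
Proof.
pose y0 := vertex_point 0; pose K := connected_component [set: Y] y0.
have join y y' t : t \in triangles -> supported y t -> supported y' t -> K y -> K y'.
  move=> tT yt y't Ky; apply: (connected_component_trans Ky).
  have [g [cg g0 g1 _]] := segment_path tT yt y't.
  exists (g @` [set: R]) => //=; last by exists 1.
  split=> //; first by exists 0.
  apply: connected_continuous_connected; last exact: continuous_subspaceT.
  by apply/connected_intervalP => a b _ _ c _.
have vK n : (n < 30)%N -> K (vertex_point n).
  move=> n30; apply: (@grow_ind (fun n => K (vertex_point n)) triangles 0 6).
  - exact: connected_component_refl.
  - move=> t b c tT bt ct.
    exact: (join _ _ t tT (vertex_point_supported tT bt) (vertex_point_supported tT ct)).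
  - by apply: (allP grow_all); rewrite mem_iota.
have -> : [set: Y] = K.
  apply/seteqP; split=> // y _; have [t tT yt] := realization_supported y.
  have /and3P[_ /allP lt /eqP st] := allP triangles_size t tT.
  have ht : head 0%N t \in t by case: (t) st => //= *; rewrite inE eqxx.
  apply: (join (vertex_point (head 0%N t)) _ t) => //; last exact/vK/lt.
  exact: vertex_point_supported.
exact: component_connected.
Qed.

(** Intermediate value theorem on the segment from y to y'. *)
Lemma same_sign (f : Y -> R) t y y' : continuous f -> t \in triangles ->
  (forall z, supported z t -> f z != 0) -> supported y t -> supported y' t ->
  (0 < f y) = (0 < f y').
Proof.
move=> cf tT f0 yt y't; have [g [cg g0 g1 gt]] := segment_path tT yt y't.
apply/eqP/negPn; apply/negP => neq.
have [|||s _ fs] := @IVT R (f \o g) 0 1 0.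
- exact: ler01.
- by apply: continuous_subspaceT => s; apply: continuous_comp; [exact: cg|exact: cf].
- rewrite /= g0 g1; have := f0 _ yt; have := f0 _ y't.
  by move: neq; rewrite le_max ge_min; case: (ltgtP 0 (f y)); case: (ltgtP 0 (f y')).
by have := f0 _ (gt s); rewrite [f _]fs eqxx.
Qed.
End Realization.

(** * The homeomorphism *)

Section Homeomorphism.
Variable R : realType.

Lemma acos_ge_pihalf (x : R) : -1 <= x <= 1 -> (pi / 2 <= acos x) = (x <= 0).
Proof.
move=> x1; have p0 := @pi_ge0 R.
rewrite -[in RHS](acosK (x := x)) ?in_itv //= -(@cos_pihalf R).
rewrite !leNgt ltr_cos // in_itv /=.
  by rewrite acos_ge0 // acos_lepi.
by apply/andP; split; lra.
Qed.

Definition points (U : 'M[R]_(5, 3)) (n : nat) : 'rV[R]_3 := row (inord n) U.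

(** On [-1, 1] the arc cosine is at least pi / 2 exactly on the nonpositive numbers. *)
Lemma conf_obtuse U : Conf 5 (pi / 2 : R) U <-> obtuse (points U).
Proof.
split=> [[U1 U0]|[U1 U0]].
  split=> [n _|m n m5 n5 mn]; first exact: U1.
  have : (inord m : 'I_5) != inord n.
    by rewrite -val_eqE /= !inordK.
  by move/U0; rewrite /angular_dist acos_ge_pihalf // unit_dotv_bound //; exact: U1.
have u1 (i : 'I_5) : dotv (row i U) (row i U) = 1.
  by have := U1 i (ltn_ord i); rewrite /points inord_val.
split=> [i|i j ij]; first exact: u1.
rewrite /angular_dist acos_ge_pihalf ?unit_dotv_bound //.
by have := U0 i j (ltn_ord i) (ltn_ord j) ij; rewrite /points !inord_val.
Qed.

Local Notation C := (Conf 5 (pi / 2 : R)).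

Lemma conf_valP (U : C) : obtuse (points (set_val U)).
Proof. by apply/conf_obtuse; exact: (set_valP U). Qed.

Lemma cont_dotv (T : topologicalType) (f g : T -> 'rV[R]_3) :
  (forall i, continuous (fun x => f x 0 i)) -> (forall i, continuous (fun x => g x 0 i)) ->
  continuous (fun x => dotv (f x) (g x)).
Proof.
move=> cf cg.
rewrite (_ : (fun x => _) = fun x => f x 0 0 * g x 0 0 + f x 0 1 * g x 0 1 +
    f x 0 2%:R * g x 0 2%:R); last by apply/funext => x; rewrite dotvE.
by do ?apply: contD; apply: contM.
Qed.

Lemma cont_det3 (T : topologicalType) (f g h : T -> 'rV[R]_3) :
  (forall i, continuous (fun x => f x 0 i)) -> (forall i, continuous (fun x => g x 0 i)) ->
  (forall i, continuous (fun x => h x 0 i)) ->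
  continuous (fun x => det3 (f x) (g x) (h x)).
Proof.
move=> cf cg ch.
have cofactor i j k : continuous (fun x => f x 0 i * (g x 0 j * h x 0 k - g x 0 k * h x 0 j)).
  by apply: contM => //; apply: contD; [|apply: contN]; apply: contM.
by apply: contD; [apply: contD; [|apply: contN]|]; exact: cofactor.
Qed.

Lemma cont_points i n : continuous (fun U : C => points (set_val U) n 0 i).
Proof.
rewrite (_ : (fun U => _) = (fun M : 'M[R]_(5, 3) => M (inord n) i) \o set_val); last first.
  by apply/funext => U /=; rewrite mxE.
by move=> x; apply: continuous_comp; [exact: set_val_continuous|exact: coord_continuous].
Qed.

Lemma cont_weight q : continuous (fun U : C => weight (points (set_val U)) q).
Proof.
have cB m n i : continuous (fun U : C => (points (set_val U) m - points (set_val U) n) 0 i).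
  rewrite (_ : (fun U => _) = fun U : C => points (set_val U) m 0 i - points (set_val U) n 0 i).
    by apply: contD; [|apply: contN]; exact: cont_points.
  by apply/funext => U; rewrite !mxE.
apply: cont_min; first by apply: contM; apply: cont_dotv => i; exact: cont_points.
apply: cont_max; first exact: cont_cst.
by apply: contN; apply: cont_det3 => i; [exact: cB|exact: cB|exact: cont_points].
Qed.

Lemma cont_coords : continuous (fun U : C => coords (points (set_val U))).
Proof.
apply: cont_mx => i j.
rewrite (_ : (fun U => _) = fun U : C => weight (points (set_val U)) (vertex j) *
    (total (points (set_val U)))^-1); last by apply/funext => U; rewrite mxE.
apply: contM; first exact: cont_weight.
apply: contV => [U|]; first by rewrite gt_eqF // total_gt0 //; exact: conf_valP.
by apply: cont_sum => n; exact: cont_weight.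
Qed.

(** The nonzero coordinates belong to the corners of a triangle by which u can be read. *)
Lemma coords_realization u : obtuse u -> realization_set R complexK (coords u).
Proof.
move=> uo; have [p pl us] := obtuse_normal_form uo.
have vo := obtuse_relabel pl uo; have [s1 s2 s3] := sides_ge0 vo.
have t0 := total_gt0 uo; apply/realizationP; split.
- move=> i; rewrite (triangle_coord uo pl us); apply: divr_ge0; last exact: ltW.
  by do 3?case: ifP.
- under eq_bigr do rewrite mxE.
  by rewrite -mulr_suml divff // gt_eqF.
- exists (sort leq (corners p)); first exact: corners_triangles.
  by move=> i; rewrite mem_sort; exact: coord_neq0_corners.
Qed.

Definition bary (U : C) : realization R complexK :=
  SigSub (mem_set (coords_realization (conf_valP U))).

Lemma cont_bary : continuous bary.
Proof. by apply: set_type_continuous; exact: cont_coords. Qed.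

(** Dot products and determinants are invariant under rotations. *)
Lemma weight_rotation (u u' : nat -> 'rV[R]_3) A q : SO3 A -> perm_eq q id5 ->
  (forall n, (n < 5)%N -> u' n = u n *m A^T) -> weight u' q = weight u q.
Proof.
move=> [AA dA] qp uE.
have {qp uE} uE n : (n < 5)%N -> u' (nth 0%N q n) = u (nth 0%N q n) *m A^T.
  move=> n5; apply: uE.
  have : nth 0%N q n \in q by rewrite mem_nth ?(perm_size qp).
  by rewrite (perm_mem qp) mem_iota.
have dotA v w : dotv (v *m A^T) (w *m A^T) = dotv v w.
  by rewrite /dotv trmx_mul trmxK mulmxA -(mulmxA v) (mulmx1C AA) mulmx1.
have detA v w z : det3 (v *m A^T) (w *m A^T) (z *m A^T) = det3 v w z.
  rewrite -!det_rows3 -[RHS]mulr1 -dA -(det_tr A) -det_mulmx; congr (\det _).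
  apply/row_matrixP => i; rewrite row_mul !rowK.
  by case: i => -[|[|[|//]]].
by rewrite /weight !uE // -!mulmxBl !dotA detA.
Qed.

(** Equal coordinates give a common triangle, then equal sides by radial
    uniqueness, then equal coordinates in the frames. *)
Lemma bary_same_orbit (U V : C) : same_orbit U V <-> bary U = bary V.
Proof.
split.
  move=> /asboolP[A AO VE]; apply/val_inj/rowP => i /=; rewrite !mxE.
  have W n : (n < 30)%N -> weight (points (set_val V)) (vertex n) =
      weight (points (set_val U)) (vertex n).
    move=> n30; apply: (weight_rotation AO); first exact: vertex_perm.
    by move=> m _; rewrite /points VE row_mul.
  by rewrite /total W //; congr (_ / _); apply: eq_bigr => n _; rewrite W.
move=> /(congr1 set_val) /= E; have uo := conf_valP U; have vo := conf_valP V.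
have [p [pl us vs]] := coords_common_triangle uo vo E.
have [e1 e2 e3] := coords_sides uo vo pl us vs E.
have [A AO AE] := same_sides_rotation (obtuse_relabel pl uo) (obtuse_relabel pl vo) us vs e1 e3.
apply/asboolP; exists A => //; apply/row_matrixP => i; rewrite row_mul.
have pp : perm_eq p id5 by rewrite -labeling_perm.
have ip : (i : nat) \in p by rewrite (perm_mem pp) mem_iota; exact: ltn_ord.
have i5 : (index (i : nat) p < 5)%N by have := ip; rewrite -index_mem (size_labeling pl).
have := AE _ i5.
by rewrite /relabel nth_index // /points inord_val.
Qed.

Lemma bary_surj y : exists U, bary U = y.
Proof.
have /realizationP[y0 y1 [t tT st]] := set_valP y.
have [p pl tE] := triangles_corners tT.
have [|u uo uE] := coords_surj pl y0 y1; first by move=> i /st; rewrite tE.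
pose U : 'M[R]_(5, 3) := \matrix_i u i.
have UE n : (n < 5)%N -> points U n = u n by move=> n5; rewrite /points rowK inordK.
have UC : C U.
  by apply/conf_obtuse; case: uo => u1 u0; split=> *; rewrite !UE // ?u1 // u0.
exists (SigSub (mem_set UC)); apply/val_inj => /=; rewrite -uE.
have W n : (n < 30)%N -> weight (points U) (vertex n) = weight u (vertex n).
  move=> n30; have := @weight_rotation u (points U) 1%:M _ _ (vertex_perm n30); apply.
    by split; rewrite ?det1 // trmx1 mulmx1.
  by move=> m m5; rewrite UE // trmx1 mulmx1.
apply/rowP => i; rewrite !mxE /total W //.
by congr (_ / _); apply: eq_bigr => n _; rewrite W.
Qed.

Lemma compact_conf : compact [set: C].
Proof.
apply: compact_set_type; apply: compact_mx => [|U i j].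
  have -> : C = [set U | forall n, (n < 5)%N -> dotv (points U n) (points U n) = 1] `&`
     [set U | forall m n, (m < 5)%N -> (n < 5)%N -> m != n -> dotv (points U m) (points U n) <= 0].
    by apply/seteqP; split=> U; [move/conf_obtuse|move=> H; apply/conf_obtuse].
  have cP m n : continuous (fun U => dotv (points U m) (points U n)).
    have cr k i : continuous (fun U => points U k 0 i).
      rewrite (_ : (fun U => _) = fun M : 'M[R]_(5, 3) => M (inord k) i).
        exact: coord_continuous.
      by apply/funext => U; rewrite mxE.
    by apply: cont_dotv => i; exact: cr.
  apply: closedI.
    rewrite (_ : [set U | _] = \bigcap_(n in [set n | (n < 5)%N])
        ((fun U => dotv (points U n) (points U n)) @^-1` [set 1])); last by [].
    apply: closed_bigI => n _; move/continuous_closedP: (cP n n); apply.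
    exact: closed_eq.
  rewrite (_ : [set U | _] = \bigcap_(mn in [set mn | [/\ (mn.1 < 5)%N, (mn.2 < 5)%N & mn.1 != mn.2]])
      ((fun U => dotv (points U mn.1) (points U mn.2)) @^-1` [set x | x <= 0])); last first.
    apply/seteqP; split=> U H; first by move=> [m n] /= [m5 n5 mn]; exact: H.
    by move=> m n m5 n5 mn; apply: (H (m, n)).
  apply: closed_bigI => n _; move/continuous_closedP: (cP n.1 n.2); apply.
  exact: closed_le.
move=> [+ _] => /(_ i); rewrite /sphere2 /= dotvE !mxE => E.
have : U i j ^+ 2 <= 1.
  have ge0 k : 0 <= U i k ^+ 2 by exact: sqr_ge0.
  have [] : [\/ j = 0, j = 1 | j = 2%:R].
    by case: j => -[|[|[|//]]] ?; [constructor 1|constructor 2|constructor 3]; apply/val_inj.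
  - by move=> ->; have := ge0 1; have := ge0 2%:R; nra.
  - by move=> ->; have := ge0 0; have := ge0 2%:R; nra.
  - by move=> ->; have := ge0 0; have := ge0 1; nra.
by move=> ?; apply/andP; split; nra.
Qed.

Lemma compact_BConf : compact [set: BConf 5 (pi / 2 : R)].
Proof.
pose Q := quotient_topology {eq_quot @orbit_equiv R 5 (pi / 2)}.
have -> : [set: BConf 5 (pi / 2 : R)] = \pi_Q @` [set: C].
  by apply/seteqP; split=> // x _; exists (repr (x : Q)) => //; rewrite reprK.
apply: continuous_compact; last exact: compact_conf.
by apply: continuous_subspaceT; exact: pi_continuous.
Qed.

Lemma BConf_homeomorphic : homeomorphic (BConf 5 (pi / 2 : R)) (realization R complexK).
Proof.
pose Q := quotient_topology {eq_quot @orbit_equiv R 5 (pi / 2)}.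
have piP (U V : C) : (\pi_Q U = \pi_Q V :> Q) <-> same_orbit U V.
  by split=> [/(eqmodP (orbit_equiv 5 (pi / 2)))|UV]; last exact/(eqmodP (orbit_equiv 5 (pi / 2))).
apply: (@compact_bij_homeomorphic Q _ (bary \o repr)).
- exact: compact_BConf.
- by apply: hausdorff_set_type; exact: norm_hausdorff.
- apply: repr_comp_continuous; first exact: cont_bary.
  by move=> U V /eqP/piP/bary_same_orbit ->.
- by move=> x y /= /bary_same_orbit/piP; rewrite !reprK.
- move=> y; have [U <-] := bary_surj y; exists (\pi_Q U : Q).
  by apply/esym/bary_same_orbit/piP; rewrite reprK.
Qed.
End Homeomorphism.

(** * A map to the punctured plane with no square root *)

Section NonContractible.
Variable R : realType.
Local Notation Y := (realization R complexK).

Definition coordN (n : nat) (y : Y) : R := set_val y 0 (inord n).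

(** Together with [wind_im] this maps the complex to the plane minus the origin: the
    triangle with corners 5, 8, 14 goes to the line of real part -1, with 5 and 8 on one
    side of the real axis and 14 on the other, and no point outside this triangle
    goes to the negative real axis.  A loop that passes once through this triangle
    from 14 to 5 therefore winds once around the origin. *)
Definition wind_re (y : Y) : R := 1 - 2 * (coordN 5 y + coordN 8 y + coordN 14 y).
Definition wind_im (y : Y) : R := coordN 5 y + coordN 8 y - coordN 14 y.

Lemma cont_coordN n : continuous (coordN n).
Proof. exact: cont_coordY. Qed.

Lemma cont_wind_re : continuous wind_re.
Proof.
apply: contD; first exact: cont_cst.
apply: contN; apply: contM; first exact: cont_cst.
by apply: contD; [apply: contD|]; exact: cont_coordN.
Qed.

Lemma cont_wind_im : continuous wind_im.
Proof. by apply: contD; [apply: contD|apply: contN]; exact: cont_coordN. Qed.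

Lemma wind_re_cut y : supported y [:: 5; 8; 14]%N -> wind_re y = -1.
Proof.
move=> yt; rewrite /wind_re /coordN.
suff -> : set_val y 0 (inord 5) + set_val y 0 (inord 8) + set_val y 0 (inord 14) = 1 by lra.
rewrite -(coordY_sum y) (bigD1 (inord 5)) //= -addrA; congr (_ + _).
rewrite (bigD1 (inord 8)) /=; last by rewrite -val_eqE /= !inordK.
congr (_ + _); rewrite (bigD1 (inord 14)) /=; last by rewrite -!val_eqE /= !inordK.
rewrite big1 ?addr0 // => i; rewrite -!val_eqE /= !inordK // => /andP[/andP[i5 i8] i14].
by apply: (coordY_out yt); rewrite !inE (negPf i5) (negPf i8).
Qed.

Lemma wind_other y t : t \in behead triangles -> supported y t ->
  wind_im y = 0 -> wind_re y = 1.
Proof.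
move=> tT yt; have /andP[_ c1] := allP other_triangles t tT.
have z n : (n < 30)%N -> (n \in t) = false -> coordN n y = 0.
  by move=> n30 nt; apply: (coordY_out yt); rewrite inordK // nt.
move: c1; rewrite /wind_im /wind_re /=.
case t5 : (5%N \in t); case t8 : (8%N \in t); case t14 : (14%N \in t) => //= _;
  try rewrite (z 5%N erefl t5); try rewrite (z 8%N erefl t8);
  try rewrite (z 14%N erefl t14); lra.
Qed.

Lemma wind_neq0 y : 0 < wind_re y ^+ 2 + wind_im y ^+ 2.
Proof.
have [t + yt] := realization_supported y; rewrite trianglesE inE => /orP[/eqP tE|tT].
  by rewrite tE in yt; rewrite (wind_re_cut yt); nra.
have [b0|b0] := eqVneq (wind_im y) 0; first by rewrite (wind_other tT yt b0) b0; nra.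
have : 0 < wind_im y ^+ 2 by rewrite lt_neqAle sqr_ge0 eq_sym sqrf_eq0 b0.
by have := sqr_ge0 (wind_re y); lra.
Qed.

(** The real part p of a square root vanishes only over the negative real axis, so
    its sign is the same at 5 and 14 by the chain of triangles around the loop.
    The imaginary part q does not vanish on the triangle with corners 5, 8, 14, so
    its sign is also the same at 5 and 14.  But 2 p q has opposite signs at these
    two vertices. *)
Lemma wind_no_sqrt : ~ has_sqrt wind_re wind_im.
Proof.
move=> [p [q [cp cq pq]]].
pose v5 := vertex_point R 5; pose v14 := vertex_point R 14.
have s5 : supported v5 [:: 5; 8; 14]%N by exact: vertex_point_supported cut_triangle _.
have s14 : supported v14 [:: 5; 8; 14]%N by exact: vertex_point_supported cut_triangle _.
have im5 : wind_im v5 = 1 by rewrite /wind_im /coordN !vertex_pointE // !inordK //=; lra.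
have im14 : wind_im v14 = -1 by rewrite /wind_im /coordN !vertex_pointE // !inordK //=; lra.
have around : (0 < p v14) = (0 < p v5).
  apply: (@grow_ind (fun n => (0 < p (vertex_point R n)) = (0 < p v5)) _ _ _ erefl _ _ grow_around).
  move=> t b c tT bt ct <-; have /andP[tT' _] := allP other_triangles t tT.
  apply: (same_sign cp tT'); try exact: vertex_point_supported.
  move=> z zt; apply/eqP => p0; have [d d0 [E1 E2]] := pq z.
  rewrite p0 mulr0 mul0r in E2; have /eqP := esym E2; rewrite mulf_eq0 gt_eqF //= => /eqP im0.
  by rewrite (wind_other tT zt im0) p0 in E1; nra.
have across : (0 < q v5) = (0 < q v14).
  apply: (same_sign cq cut_triangle) => // z zt; apply/eqP => q0; have [d d0 [E1 _]] := pq z.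
  by rewrite (wind_re_cut zt) q0 in E1; nra.
have [d5 d50 [_ E5]] := pq v5; have [d14 d140 [_ E14]] := pq v14.
rewrite im5 in E5; rewrite im14 in E14; move: around across E5 E14.
case: (ltP 0 (p v14)); case: (ltP 0 (p v5)); case: (ltP 0 (q v14)); case: (ltP 0 (q v5)) => //; nra.
Qed.

Lemma homeomorphic_not_contractible (X : topologicalType) :
  compact [set: X] -> homeomorphic X Y -> ~ contractible R X.
Proof.
move=> cX [f [g [cf cg fK gK]]] ctr; apply: wind_no_sqrt.
have comp (T : topologicalType) (h : Y -> T) : continuous h -> continuous (h \o f).
  by move=> ch x; apply: continuous_comp; [exact: cf|exact: ch].
have [p [q [cp cq pq]]] := contractible_has_sqrt cX ctr (comp _ _ cont_wind_re)
  (comp _ _ cont_wind_im) (fun x => wind_neq0 (f x)).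
exists (p \o g), (q \o g); split.
- by move=> y; apply: continuous_comp; [exact: cg|exact: cp].
- by move=> y; apply: continuous_comp; [exact: cg|exact: cq].
- by move=> y; have := pq (g y); rewrite /= gK.
Qed.

Lemma homeomorphic_connected (X : topologicalType) :
  homeomorphic X Y -> connected [set: X].
Proof.
move=> [f [g [cf cg fK gK]]].
have -> : [set: X] = g @` [set: Y] by apply/seteqP; split=> // x _; exists (f x).
apply: connected_continuous_connected; first exact: connected_realization.
exact: continuous_subspaceT.
Qed.
End NonContractible.

(** * The maximal radius *)

Section Radius.
Variable R : realType.
Implicit Type s : R.

Lemma touching_angle_bounds s : 0 <= s -> 0 <= touching_angle s <= pi.
Proof.
move=> s0; have s1 : 0 < 1 + s by rewrite ltr_pwDl.
have x0 : 0 <= s / (1 + s) by rewrite divr_ge0 // ltW.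
have x1 : s / (1 + s) <= 1 by rewrite ler_pdivrMr // mul1r lerDr.
have xI : -1 <= s / (1 + s) <= 1 by rewrite x1 (le_trans (lerN10 R)).
have := asin_lepi2 xI; have := asin_geNpi2 xI.
have p0 := pi_gt0 R.
have y0 : 0 <= asin (s / (1 + s)).
  rewrite leNgt; apply/negP => yn.
  have : sin (asin (s / (1 + s))) < sin 0.
    rewrite ltr_sin // in_itv /=; last by apply/andP; split; lra.
    by rewrite asin_geNpi2 // asin_lepi2.
  by rewrite asinK ?in_itv // sin0 ltNge x0.
by rewrite /touching_angle => *; apply/andP; split; lra.
Qed.

Lemma cos_touching_angle s : 0 <= s -> cos (touching_angle s) = 1 - 2 * (s / (1 + s)) ^+ 2.
Proof.
move=> s0; rewrite -(touching_angleE s0).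
have {1}-> : touching_angle s = (touching_angle s / 2) *+ 2.
  by rewrite -mulr_natr mulfVK // pnatr_eq0.
by rewrite cos_mulr2n cos2sin2 -mulr_natl; ring.
Qed.

(** Comparing cosines turns the inequality into 2 s^2 <= (1 + s)^2. *)
Lemma touching_angle_le_pihalf s : 0 <= s ->
  (touching_angle s <= pi / 2) = (s <= 1 + Num.sqrt 2).
Proof.
move=> s0; have p0 := pi_gt0 R.
have s1 : 0 < 1 + s by rewrite ltr_pwDl.
rewrite !leNgt -(ltr_cos (R := R)); first last.
- by rewrite in_itv /= touching_angle_bounds.
- by rewrite in_itv /=; apply/andP; split; lra.
rewrite cos_pihalf cos_touching_angle // subr_lt0 expr_div_n; congr (~~ _).
rewrite mulrA ltr_pdivlMr ?exprn_gt0 // mul1r.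
have q0 := sqrtr_ge0 (2 : R); have qE : Num.sqrt 2 ^+ 2 = 2 :> R by rewrite sqr_sqrtr.
move: q0 qE; set q := Num.sqrt 2 => q0 qE.
have q1 : 1 <= q by nra.
have E : 2 * s ^+ 2 - (1 + s) ^+ 2 = (s - 1 - q) * (s - 1 + q) by nra.
apply/idP/idP => H.
  rewrite ltNge; apply/negP => H'.
  have : 0 <= (1 + q - s) * (s - 1 + q) by apply: mulr_ge0; lra.
  by lra.
have : 0 < (s - 1 - q) * (s - 1 + q) by apply: mulr_gt0; lra.
by lra.
Qed.

Lemma touching_angle_max : touching_angle (1 + Num.sqrt 2 : R) = pi / 2.
Proof.
have q0 := sqrtr_ge0 (2 : R); have qE : Num.sqrt 2 ^+ 2 = 2 :> R by rewrite sqr_sqrtr.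
have r0 : 0 <= 1 + Num.sqrt 2 :> R by lra.
have p0 := pi_gt0 R.
apply: cos_inj.
- by rewrite in_itv /= touching_angle_bounds.
- by rewrite in_itv /=; apply/andP; split; lra.
rewrite cos_pihalf cos_touching_angle //.
have n0 : 1 + (1 + Num.sqrt 2) != 0 :> R by rewrite gt_eqF //; lra.
rewrite expr_div_n; apply/eqP; rewrite subr_eq0 mulrA.
by apply/eqP; rewrite (_ : 2 * (1 + Num.sqrt 2) ^+ 2 = (1 + (1 + Num.sqrt 2)) ^+ 2) ?divff ?expf_neq0 //; nra.
Qed.

(** A larger angle would make all the dot products negative, while a pole is
    orthogonal to the equatorial points. *)
Lemma conf_angle_le (theta : R) : Conf 5 theta !=set0 -> theta <= pi / 2.
Proof.
move=> [U [U1 U0]]; rewrite leNgt; apply/negP => lt.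
have uo : obtuse (points U).
  by apply/conf_obtuse; split=> // i j ij; apply: le_trans (U0 i j ij); exact: ltW.
have [p pl [_ [z _ _] _]] := obtuse_normal_form uo.
have /and3P[p0 p2 p02] : [&& nth 0 p 0 < 5, nth 0 p 2 < 5 & nth 0 p 0 != nth 0 p 2]%N.
  by move: p pl {z}; apply/allP; vm_compute.
have := U0 (inord (nth 0%N p 0)) (inord (nth 0%N p 2)).
rewrite -val_eqE /= !inordK // => /(_ p02).
by rewrite /angular_dist [dotv _ _]z acos0 leNgt lt.
Qed.
End Radius.

Theorem mainTheorem6 (R : realType) :
  let r : R := 1 + Num.sqrt 2 in
  let X : topologicalType := BConf_radius 5 r in
  [/\ is_max_radius 5 r,
      X = BConf 5 (pi / 2 : R),
      exists (n : nat) (K : {set {set 'I_n}}),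
        [/\ simplicial_complex K,
            complex_dim K = 2%N,
            homeomorphic X (realization R K) &
            euler_char K = - 10%:Z],
      ~ contractible R X &
      exists C : set X, connected_components X = [set C]].
Proof.
move=> r X; have XE : X = BConf 5 (pi / 2 : R) by rewrite /X /BConf_radius touching_angle_max.
have cX : compact [set: X] by rewrite XE; exact: compact_BConf.
have hX : homeomorphic X (realization R complexK) by rewrite XE; exact: BConf_homeomorphic.
have q0 := sqrtr_ge0 (2 : R).
have [f [g [_ _ _ _]]] := hX; pose x0 : X := g (vertex_point R 0).
split=> //.
- split; [by rewrite /r; lra|by exists x0|].
  move=> s s0 [x _]; rewrite -touching_angle_le_pihalf; last exact: ltW.
  apply: conf_angle_le; pose y : quotient_topology {eq_quot @orbit_equiv R 5 (touching_angle s)} := x.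
  by exists (set_val (repr y)); exact: set_valP.
- exists 30%N, complexK; split=> //; [exact: simplicial_complexK|
    exact: complex_dimK|exact: euler_charK].
- exact: homeomorphic_not_contractible.
- exists setT; have cnX := homeomorphic_connected hX.
  apply/seteqP; split=> [A [x _ <-]|A ->]; first exact: connected_component_id.
  by exists x0 => //; exact: connected_component_id.
Qed.
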